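(* Up to the symmetries, the weighted small-step walks $W$ in the quadrant whose group $G_W$ is of order $10$ are precisely those with probability matrix of the form $$P_\infty=\frac1Z\begin{pmatrix}0&S^3R&S^2\\S^3R^3&P&2SR\\S^2R^4&2SR^3&R^2\end{pmatrix},$$ where $S>0$, $R>0$, $P\ge0$ are real numbers and $$Z=S^3R+S^2+S^3R^3+P+2SR+S^2R^4+2SR^3+R^2.$$
   Context: A weighted small-step walk $W$ in the quadrant is given by real weights $p_{ij}\ge 0$, $i,j\in\{-1,0,1\}$, with $\sum_{i,j=-1}^{1}p_{ij}=1$. Its probability matrix is $$P_\infty=\begin{pmatrix} p_{11} & p_{10} & p_{1,-1}\\ p_{01} & p_{00} & p_{0,-1}\\ p_{-1,1} & p_{-1,0} & p_{-1,-1}\end{pmatrix}.$$ Its inventory is $$\chi_W(x,y)=\sum_{i,j=-1}^1 p_{ij}x^iy^j = xA_1(y)+B_1(y)+\frac{C_1(y)}{x}=yA_2(x)+B_2(x)+\frac{C_2(x)}{y},$$ where $A_1,B_1,C_1$ are Laurent polynomials in $y$ and $A_2,B_2,C_2$ are Laurent polynomials in $x$. It is assumed that none of $A_1,C_1,A_2,C_2$ is identically zero, so that $$\varphi_1(x,y)=\left(\frac{C_1(y)}{xA_1(y)},\,y\right),\qquad \varphi_2(x,y)=\left(x,\,\frac{C_2(x)}{yA_2(x)}\right)$$ are birational involutions of the $(x,y)$-plane. The group of $W$ is $G_W=\langle\varphi_1,\varphi_2\rangle$, the group of birational transformations of the $(x,y)$-plane generated by them. ''Up to the symmetries'' means up to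 the action of the eight symmetries of the square on the index set $\{-1,0,1\}^2$ of the weights, generated by $(i,j)\mapsto(-i,j)$, $(i,j)\mapsto(i,-j)$ and $(i,j)\mapsto(j,i)$ (i.e. reversing the order of the rows, reversing the order of the columns, and transposing $P_\infty$). *)

(* Defs.v *)
From HB Require Import structures.
From mathcomp Require Import all_boot all_order all_algebra.
From mathcomp Require Import boolp classical_sets functions cardinality reals.

Set Implicit Arguments.
Unset Strict Implicit.
Unset Printing Implicit Defensive.

Import Order.TTheory GRing.Theory Num.Theory.

Local Open Scope classical_set_scope.
Local Open Scope ring_scope.

Section RationalMaps.
Variable F : fieldType.

(* The field F(x, y).  As in polyXY, in {poly {poly F}} the coordinate x is
   the outer variable 'X and y is the inner one 'Y = 'X%:P. *)
Definition ratfun := {fraction {poly {poly F}}}.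

Definition ratfun_const (c : F) : ratfun := tofrac (c%:P%:P).
Definition ratfun_x : ratfun := tofrac 'X.
Definition ratfun_y : ratfun := tofrac 'Y.

(* The rational map (x, y) |-> (f.1 (x, y), f.2 (x, y)) of the plane. *)
Definition ratmap := (ratfun * ratfun)%type.

Definition ratmap_id : ratmap := (ratfun_x, ratfun_y).

(* The polynomial u evaluated at x := f.1, y := f.2. *)
Definition poly_subst (f : ratmap) (u : {poly {poly F}}) : ratfun :=
  (map_poly (map_poly ratfun_const) u).[f.1, f.2].

(* The rational function h composed with f.  This is only meaningful when no
   nonzero denominator vanishes at f, which dominant ensures. *)
Definition ratfun_subst (f : ratmap) (h : ratfun) : ratfun :=
  poly_subst f (\n_(repr h)) / poly_subst f (\d_(repr h)).

(* The components of f are algebraically independent, that is, the image of f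
   lies in no curve. *)
Definition dominant (f : ratmap) : Prop :=
  forall u : {poly {poly F}}, u != 0 -> poly_subst f u != 0.

Definition ratmap_comp (g f : ratmap) : ratmap :=
  (ratfun_subst f g.1, ratfun_subst f g.2).

Definition birational_inverse (f g : ratmap) : Prop :=
  [/\ dominant f, dominant g,
      ratmap_comp g f = ratmap_id & ratmap_comp f g = ratmap_id].

Definition birational (f : ratmap) : Prop := exists g, birational_inverse f g.

(* Subgroups of the group of birational transformations of the plane. *)
Definition birational_subgroup (G : set ratmap) : Prop :=
  [/\ G `<=` birational,
      G ratmap_id,
      forall f g, G f -> G g -> G (ratmap_comp g f) &
      forall f g, G f -> birational_inverse f g -> G g].

Definition generated_subgroup (A : set ratmap) : set ratmap :=
  smallest birational_subgroup A.

Lemma ratfun_const_is_zmod_morphism : zmod_morphism ratfun_const.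
Proof. by move=> a b; rewrite /ratfun_const !rmorphB. Qed.
Lemma ratfun_const_is_monoid_morphism : monoid_morphism ratfun_const.
Proof.
by split=> [|a b]; rewrite /ratfun_const ?rmorph1 // !rmorphM.
Qed.
HB.instance Definition _ := GRing.isZmodMorphism.Build F ratfun ratfun_const
  ratfun_const_is_zmod_morphism.
HB.instance Definition _ := GRing.isMonoidMorphism.Build F ratfun ratfun_const
  ratfun_const_is_monoid_morphism.

Lemma poly_substM f u v : poly_subst f (u * v) = poly_subst f u * poly_subst f v.
Proof. by rewrite /poly_subst rmorphM !hornerM. Qed.

Lemma ratfun_numden (h : ratfun) : h * tofrac (\d_(repr h)) = tofrac (\n_(repr h)).
Proof.
rewrite -{1}[h]reprK; case: (repr h) => -[a b] /= b0.
unlock FracField.tofrac; rewrite -[LHS]FracField.pi_mul.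
apply/eqmodP; rewrite /= FracField.equivfE /FracField.mulf /=.
by rewrite !numden_Ratio ?mulr1 ?oner_eq0 //= mulrC.
Qed.

(* Substitution into a fraction does not depend on its representative. *)
Lemma ratfun_subst_frac f u v : dominant f -> v != 0 ->
  ratfun_subst f (tofrac u / tofrac v) = poly_subst f u / poly_subst f v.
Proof.
move=> fdom v0; rewrite /ratfun_subst; set h := tofrac u / tofrac v.
have d0 : \d_(repr h) != 0 by exact: (denom_ratioP (repr h)).
apply/eqP; rewrite eqr_div ?fdom//.
rewrite -!poly_substM; apply/eqP; congr poly_subst.
apply/eqP; rewrite -tofrac_eq !tofracM -ratfun_numden /h mulrAC.
by rewrite divfK ?tofrac_eq0.
Qed.

End RationalMaps.

Section Walks.
Variable K : realType.

(* A walk is given by its probability matrix P, whose entry in row k and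
   column l is the weight p_{ij} with i = step k and j = step l. *)
Definition step (k : 'I_3) : int := 1 - k%:Z.

Implicit Type P : 'M[K]_3.

Definition weighted_walk P : Prop :=
  (forall k l, 0 <= P k l) /\ \sum_k \sum_l P k l = 1.

Local Notation x := (ratfun_x K).
Local Notation y := (ratfun_y K).

Definition inventory P : ratfun K :=
  \sum_k \sum_l ratfun_const (P k l) * x ^ step k * y ^ step l.

(* The Laurent polynomial in y (resp. x) given by row k (resp. column l). *)
Definition row_laurent P (k : 'I_3) : ratfun K :=
  \sum_l ratfun_const (P k l) * y ^ step l.
Definition col_laurent P (l : 'I_3) : ratfun K :=
  \sum_k ratfun_const (P k l) * x ^ step k.

Definition A1 P := row_laurent P 0.
Definition B1 P := row_laurent P 1.
Definition C1 P := row_laurent P 2.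
Definition A2 P := col_laurent P 0.
Definition B2 P := col_laurent P 1.
Definition C2 P := col_laurent P 2.

Lemma sum3E (f : 'I_3 -> ratfun K) : \sum_k f k = f 0 + f 1 + f 2.
Proof.
rewrite !big_ord_recl big_ord0 addr0 addrA.
by congr (f _ + f _ + f _); apply: val_inj.
Qed.

Lemma inventoryE1 P : inventory P = x * A1 P + B1 P + C1 P / x.
Proof.
rewrite /inventory sum3E /A1 /B1 /C1 /row_laurent mulr_sumr mulr_suml.
congr (_ + _ + _); apply: eq_bigr => l _.
- by rewrite [step 0]/= expr1z mulrA (mulrC x).
- by rewrite [step 1]/= expr0z mulr1.
- by rewrite [step 2]/= mulrAC.
Qed.

Lemma inventoryE2 P : inventory P = y * A2 P + B2 P + C2 P / y.
Proof.
rewrite /inventory exchange_big sum3E /A2 /B2 /C2 /col_laurent.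
rewrite mulr_sumr mulr_suml; congr (_ + _ + _); apply: eq_bigr => l _.
- by rewrite [step 0]/= expr1z mulrC.
- by rewrite [step 1]/= expr0z mulr1.
Qed.

Definition nondegenerate_walk P : Prop :=
  [/\ A1 P != 0, C1 P != 0, A2 P != 0 & C2 P != 0].

Definition phi1 P : ratmap K := (C1 P / (x * A1 P), y).
Definition phi2 P : ratmap K := (x, C2 P / (y * A2 P)).

Definition walk_group P : set (ratmap K) :=
  generated_subgroup [set phi1 P; phi2 P].

Definition rev_rows P : 'M[K]_3 := \matrix_(k, l) P (rev_ord k) l.
Definition rev_cols P : 'M[K]_3 := \matrix_(k, l) P k (rev_ord l).

(* The orbit of P under the symmetries of the square.  As the generators are
   involutions, this is an equivalence relation. *)
Inductive square_symmetric P : 'M[K]_3 -> Prop :=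
| Sym_refl : square_symmetric P P
| Sym_rows Q : square_symmetric P Q -> square_symmetric P (rev_rows Q)
| Sym_cols Q : square_symmetric P Q -> square_symmetric P (rev_cols Q)
| Sym_trmx Q : square_symmetric P Q -> square_symmetric P Q^T.

Definition mx_of_rows (s : seq (seq K)) : 'M[K]_3 :=
  \matrix_(k, l) (nth [::] s k)`_l.

End Walks.

(* Main.v *)
Require Import Defs.
From mathcomp Require Import all_boot all_order all_algebra.
From mathcomp Require Import boolp classical_sets functions cardinality reals.
From mathcomp Require Import ring lra.

Set Implicit Arguments.
Unset Strict Implicit.
Unset Printing Implicit Defensive.

Import Order.TTheory GRing.Theory Num.Theory.

Local Open Scope classical_set_scope.
Local Open Scope ring_scope.

(** Put a(y) = C1(y)/A1(y) and b(x) = C2(x)/A2(x), and let u_0 = x, u_1 = y,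
    u_2, ... be the sequence in which u_(n-1) u_(n+1) equals a(u_n) when u_n
    is a y-coordinate and b(u_n) when it is an x-coordinate.  Applying phi1
    and phi2 in turn to (x, y) runs through the pairs of consecutive terms of
    this sequence, so the group is dihedral, and it has order 10 exactly when
    the sequence has period 10.  As the weights are nonnegative, phi1 and
    phi2 map the open positive quadrant to itself, and a rational function is
    determined by its values there.  Hence everything can be decided on
    sequences of positive reals: this is [walk_group_order10].

    Sufficiency.  Rescaling x and y turns a and b for the matrices of the
    theorem into 1 + y and 1 + x, and u_(n-1) u_(n+1) = 1 + u_n is the classical
    recurrence of period 5 ([pentagon_periodic]).  The symmetries of the
    square conjugate the two maps by x |-> 1/x, y |-> 1/y and the exchange of
    x and y.

    Necessity.  (1) Start at x = t, y = 1 and let t tend to 0.  As nothing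
    cancels among positive terms, u_n has the exact order of t ^ v_n, where the
    integers v_n depend only on which weights vanish.  Periodicity forces
    v_10 = 1 and v_11 = 0, and a check over all supports shows that one corner
    weight is zero and that, once a symmetry has brought it to p_11, five
    other weights are positive ([trop_periodic_corner],
    [trop_periodic_support]).

    (2) After rescaling, a(u) = (1 + c u + u^2)/(1 + l u) and
    b(u) = (1 + e u + u^2)/(1 + m u).  The periodicity is an identity between
    rational functions, so it may be examined where terms of the sequence
    have zeros and poles.  On the line x = 0 it gives l m = 1.  At (-l, -m), a
    pole of both b(x) and a(y), it is contradicted by the order of a pole
    unless a or b has a removable singularity there, that is, unless a or b is an
    affine function ([place_double_pole]).  If b is affine, another point of
    the line y = -m shows that a is affine too ([place_pole_line]).

    (3) Then a(u) = 1 + m u and b(u) = 1 + l u, and the period 10 of a single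
    orbit forces l = 1, hence c = e = 2 ([closes_pentagon]).  Undoing the
    rescaling solves for the weights ([periodic_walk_family]). *)

(** * Values of rational functions at points *)

Lemma poly_nonroot (R : idomainType) (p : {poly R}) (s : nat -> R) :
  injective s -> p != 0 -> exists i, p.[s i] != 0.
Proof.
move=> sI p0; apply: contrapT => H.
have : (size [seq s i | i <- iota 0 (size p)] < size p)%N.
  apply: max_poly_roots => //.
    apply/allP => _ /mapP[i _ ->]; apply/negPn/negP => Hi.
    by apply: H; exists i.
  by rewrite map_inj_uniq ?iota_uniq.
by rewrite size_map size_iota ltnn.
Qed.

Section Evaluation.
Variable K : realType.
Implicit Types (u n d : {poly {poly K}}) (q : K * K) (h : ratfun K) (v : K).

Definition eval2 q u : K := u.[q.1%:P].[q.2].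

Lemma eval2D q u n : eval2 q (u + n) = eval2 q u + eval2 q n.
Proof. by rewrite /eval2 !hornerD. Qed.
Lemma eval2N q u : eval2 q (- u) = - eval2 q u.
Proof. by rewrite /eval2 !hornerN. Qed.
Lemma eval2M q u n : eval2 q (u * n) = eval2 q u * eval2 q n.
Proof. by rewrite /eval2 !hornerM. Qed.
Lemma eval2C q c : eval2 q c%:P%:P = c.
Proof. by rewrite /eval2 !hornerC. Qed.
Lemma eval2X q : eval2 q 'X = q.1.
Proof. by rewrite /eval2 hornerX hornerC. Qed.
Lemma eval2Y q : eval2 q 'Y = q.2.
Proof. by rewrite /eval2 hornerC hornerX. Qed.

Definition quadrant : set (K * K) := [set q | 0 < q.1 /\ 0 < q.2].

Lemma eval2_quadrant_neq0 u : u != 0 -> exists2 q, quadrant q & eval2 q u != 0.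
Proof.
have nI : injective (fun i : nat => i.+1%:R : K).
  by move=> i j /eqP; rewrite eqr_nat => /eqP[].
have nPI : injective (fun i : nat => (i.+1%:R)%:P : {poly K}).
  by move=> i j /polyC_inj /nI.
move=> /(poly_nonroot nPI)[i] /(poly_nonroot nI)[j] Hj.
by exists (i.+1%:R, j.+1%:R); rewrite // /quadrant /= !ltr0Sn.
Qed.

(** [h] is defined at [q] with value [v].  The fraction may depend on [q]: this
    makes the predicate stable under the field operations at every point,
    also where some other fraction for [h] would be 0/0. *)
Definition value_at q h v : Prop :=
  exists n d, [/\ eval2 q d != 0, h = tofrac n / tofrac d & v = eval2 q n / eval2 q d].

Lemma eval2_neq0 q d : eval2 q d != 0 -> d != 0.
Proof. by apply: contraNneq => ->; rewrite /eval2 !hornerC. Qed.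

(** The cleared form also covers fractions whose denominator vanishes at [q]. *)
Lemma value_at_frac q h v n d : h = tofrac n / tofrac d -> d != 0 -> value_at q h v ->
  eval2 q n = v * eval2 q d.
Proof.
move=> -> d0 [n' [d' [d'q e ->]]].
have d'0 := eval2_neq0 d'q.
move/eqP: e; rewrite eqr_div ?tofrac_eq0 // -!tofracM tofrac_eq => /eqP e.
apply: (mulIf d'q); rewrite mulrAC divfK // -!eval2M e mulrC //.
Qed.

Lemma value_at_uniq q h v w : value_at q h v -> value_at q h w -> v = w.
Proof.
move=> [n [d [dq e ->]]] /(value_at_frac e (eval2_neq0 dq)) ->.
by rewrite mulfK.
Qed.

Lemma value_at_poly q u : value_at q (tofrac u) (eval2 q u).
Proof.
have e1 : eval2 q 1 = 1 by exact: eval2C.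
by exists u, 1; rewrite e1 tofrac1 !divr1 oner_neq0.
Qed.
Lemma value_at_const q c : value_at q (ratfun_const c) c.
Proof. by have := value_at_poly q c%:P%:P; rewrite eval2C. Qed.
Lemma value_at_x q : value_at q (ratfun_x K) q.1.
Proof. by have := value_at_poly q 'X; rewrite eval2X. Qed.
Lemma value_at_y q : value_at q (ratfun_y K) q.2.
Proof. by have := value_at_poly q 'Y; rewrite eval2Y. Qed.
Lemma value_at0 q : value_at q 0 0.
Proof. by have := value_at_const q 0; rewrite rmorph0. Qed.
Lemma value_at_eq q h v w : value_at q h w -> w = v -> value_at q h v.
Proof. by move=> ? <-. Qed.

Lemma value_atD q h g v w :
  value_at q h v -> value_at q g w -> value_at q (h + g) (v + w).
Proof.
move=> [n [d [dq -> ->]]] [n' [d' [dq' -> ->]]].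
exists (n * d' + n' * d), (d * d'); split.
- by rewrite eval2M mulf_neq0.
- by rewrite addf_div ?tofrac_eq0 ?(eval2_neq0 dq) ?(eval2_neq0 dq') // !tofracM !rmorphD /= !tofracM.
- by rewrite addf_div // eval2D !eval2M.
Qed.
Lemma value_atN q h v : value_at q h v -> value_at q (- h) (- v).
Proof.
move=> [n [d [dq -> ->]]]; exists (- n), d.
by rewrite eval2N tofracN !mulNr.
Qed.
Lemma value_atM q h g v w :
  value_at q h v -> value_at q g w -> value_at q (h * g) (v * w).
Proof.
move=> [n [d [dq -> ->]]] [n' [d' [dq' -> ->]]].
exists (n * n'), (d * d'); split.
- by rewrite eval2M mulf_neq0.
- by rewrite mulf_div !tofracM.
- by rewrite mulf_div !eval2M.
Qed.
Lemma value_at_neq0 q h v : value_at q h v -> v != 0 -> h != 0.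
Proof.
move=> H; apply: contraNneq => h0; apply/eqP.
by apply: (value_at_uniq H); rewrite h0; exact: value_at0.
Qed.
Lemma value_atV q h v : value_at q h v -> v != 0 -> value_at q h^-1 v^-1.
Proof.
move=> [n [d [dq -> ->]]] v0; exists d, n.
rewrite !invf_div; split=> //.
by apply: contraNneq v0 => ->; rewrite mul0r.
Qed.
Lemma value_at_div q h g v w :
  value_at q h v -> value_at q g w -> w != 0 -> value_at q (h / g) (v / w).
Proof. by move=> ? ? ?; apply: value_atM => //; apply: value_atV. Qed.

(** A polynomial that vanishes on a product of two infinite sets is zero, so
    agreement on the positive quadrant is agreement. *)
Lemma value_at_inj h g :
  (forall q, quadrant q -> exists2 v, value_at q h v & value_at q g v) -> h = g.
Proof.
move=> H; apply/eqP; rewrite -subr_eq0.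
pose r := repr (h - g); have d0 : \d_r != 0 by exact: denom_ratioP.
have e : h - g = tofrac (\n_r) / tofrac (\d_r).
  by rewrite -ratfun_numden mulfK // tofrac_eq0.
have [n0|/eval2_quadrant_neq0[q Qq]] := eqVneq (\n_r) 0.
  by rewrite e n0 tofrac0 mul0r.
have [v hv gv] := H q Qq.
have := value_atD hv (value_atN gv).
move=> /(value_at_frac e d0) ->.
by rewrite subrr mul0r eqxx.
Qed.

Lemma poly_subst_value f q q' u : value_at q f.1 q'.1 -> value_at q f.2 q'.2 ->
  value_at q (poly_subst f u) (eval2 q' u).
Proof.
move=> H1 H2; elim/poly_ind: u => [|u c IHu].
  rewrite /poly_subst map_poly0 horner0 /eval2 !horner0.
  exact: value_at0.
rewrite /poly_subst rmorphD rmorphM /= map_polyX map_polyC /= !hornerE.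
rewrite eval2D eval2M eval2X; apply: value_atD.
  exact: value_atM.
rewrite /eval2 hornerC; elim/poly_ind: c => [|c k IHc].
  rewrite map_poly0 !horner0; exact: value_at0.
rewrite rmorphD rmorphM /= map_polyX map_polyC /= !hornerE.
by apply: value_atD; [exact: value_atM|exact: value_at_const].
Qed.

Lemma ratfun_subst_value f q q' h v : dominant f ->
  value_at q f.1 q'.1 -> value_at q f.2 q'.2 -> value_at q' h v ->
  value_at q (ratfun_subst f h) v.
Proof.
move=> fdom H1 H2 [n [d [dq -> ->]]].
rewrite ratfun_subst_frac ?(eval2_neq0 dq) //.
by apply: value_at_div => //; exact: poly_subst_value.
Qed.

End Evaluation.

(** * Two involutions applied in turn *)

Section Alternation.
Variables (K : realType) (a b : K -> K).
Hypothesis a_gt0 : forall y : K, 0 < y -> 0 < a y.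
Hypothesis b_gt0 : forall x : K, 0 < x -> 0 < b x.
Local Notation Q := (@quadrant K).
Implicit Types (q : K * K) (i j k m n d r : nat) (c : bool).

(** [flip false] and [flip true] are the values of phi1 and phi2 at a point. *)
Definition flip c q : K * K :=
  if c then (q.1, b q.1 / q.2) else (a q.2 / q.1, q.2).

Fixpoint alternate n q : K * K :=
  if n is m.+1 then flip (odd m) (alternate m q) else q.

Lemma flip_quadrant c q : Q q -> Q (flip c q).
Proof.
by move=> [q1 q2]; case: c; split=> //=; apply: divr_gt0; rewrite ?a_gt0 ?b_gt0.
Qed.

Lemma flipK c q : Q q -> flip c (flip c q) = q.
Proof.
case: q => x y [/= x0 y0]; rewrite /flip; case: c => /=; congr pair;
  by rewrite invf_div mulrCA divff ?mulr1 // gt_eqF ?a_gt0 ?b_gt0.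
Qed.

Lemma flip_not_id c : ~ (forall q, Q q -> flip c q = q).
Proof.
have Q1 : Q (1, 1) by split=> /=; rewrite ltr01.
have Q2 : Q (1, 2%:R) by split=> /=; rewrite ?ltr01 ?ltr0n.
have Q2' : Q (2%:R, 1) by split=> /=; rewrite ?ltr01 ?ltr0n.
case: c => H.
  have [] := H _ Q1; have [] := H _ Q2; rewrite divr1 => /[swap] -> /eqP.
  by rewrite eq_sym -subr_eq0 => /eqP; lra.
have [] := H _ Q1; have [] := H _ Q2'; rewrite divr1 => /[swap] -> /eqP.
by rewrite eq_sym -subr_eq0 => /eqP; lra.
Qed.

Lemma alternate_quadrant n q : Q q -> Q (alternate n q).
Proof. by elim: n => //= n IHn /IHn; exact: flip_quadrant. Qed.

Fixpoint unalternate n q : K * K :=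
  if n is m.+1 then unalternate m (flip (odd m) q) else q.

Lemma unalternate_quadrant n q : Q q -> Q (unalternate n q).
Proof. by elim: n q => //= n IHn q /flip_quadrant Qq; exact: IHn. Qed.

Lemma alternateK n q : Q q -> unalternate n (alternate n q) = q.
Proof.
elim: n => //= n IHn Qq; rewrite flipK ?IHn //; exact: alternate_quadrant.
Qed.

Lemma unalternateK n q : Q q -> alternate n (unalternate n q) = q.
Proof.
elim: n q => //= n IHn q Qq; rewrite IHn ?flipK //; exact: flip_quadrant.
Qed.

Lemma alternateD m n q : ~~ odd n -> alternate (m + n) q = alternate m (alternate n q).
Proof. by move=> n2; elim: m => //= m ->; rewrite oddD (negPf n2) addbF. Qed.

(** Two terms of different parity cannot agree: the map applied next to the one
    is the map applied last to the other, so the coincidence moves inwards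
    until two neighbouring terms agree, and an involution is the identity. *)
Lemma alternate_neq n d : odd d ->
  ~ (forall q, Q q -> alternate n q = alternate (n + d) q).
Proof.
elim/ltn_ind: d n => -[//|[|d]] IHd n d1 H.
  apply: (@flip_not_id (odd n)) => q Qq.
  have := H (unalternate n q) (unalternate_quadrant n Qq).
  by rewrite addn1 /= unalternateK.
rewrite /= negbK in d1.
apply: (IHd d _ n.+1) => // q Qq.
rewrite [LHS]/= H // !addnS [alternate _.+2 _]/= addSn oddD d1 addbT negbK.
rewrite flipK; last by apply: flip_quadrant; apply: alternate_quadrant.
by rewrite /= oddD d1 addbT.
Qed.

Lemma alternate_eq n d : (forall q, Q q -> alternate n q = alternate (n + d) q) ->
  ~~ odd d /\ forall q, Q q -> alternate d q = q.
Proof.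
have [d1 /(alternate_neq d1)//|d2 H] := boolP (odd d); split=> // q Qq.
rewrite -(alternateK n (alternate_quadrant d Qq)) -alternateD // -H //.
exact: alternateK.
Qed.

End Alternation.

(** * From rational maps to maps of the quadrant *)

Section Representation.
Variable K : realType.
Local Notation Q := (@quadrant K).
Implicit Types (E F : ratmap K) (T U : K * K -> K * K) (q : K * K).

(** Birational maps are only composed through this relation: it turns identities
    between rational maps into pointwise identities, and conversely. *)
Definition represents E T : Prop := forall q, Q q ->
  [/\ Q (T q), value_at q E.1 (T q).1 & value_at q E.2 (T q).2].

Lemma represents_inj E F T :
  represents E T -> represents F T -> E = F.
Proof.
case: E F => [e1 e2] [f1 f2] ET FT.
have -> : e1 = f1.
  by apply: value_at_inj => q /[dup] /ET[_ E1 _] /FT[_ F1 _]; exists (T q).1.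
suff -> : e2 = f2 by [].
by apply: value_at_inj => q /[dup] /ET[_ _ E2] /FT[_ _ F2]; exists (T q).2.
Qed.

Lemma represents_fun E T U q : represents E T -> represents E U -> Q q -> T q = U q.
Proof.
move=> ET EU Qq; have [_ T1 T2] := ET q Qq; have [_ U1 U2] := EU q Qq.
rewrite [T q]surjective_pairing [U q]surjective_pairing.
by rewrite (value_at_uniq T1 U1) (value_at_uniq T2 U2).
Qed.

Lemma represents_ext E T U : represents E T -> (forall q, Q q -> T q = U q) ->
  represents E U.
Proof. by move=> ET TU q /[dup] /TU <- /ET. Qed.

Lemma represents_id : represents (ratmap_id K) id.
Proof. by move=> q Qq; split=> //; [exact: value_at_x|exact: value_at_y]. Qed.

(** A polynomial that vanished on the image of a map onto the quadrant would
    vanish on the quadrant. *)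
Lemma represents_dominant E T U : represents E T ->
  (forall q, Q q -> Q (U q) /\ T (U q) = q) -> dominant E.
Proof.
move=> ET TU u /eval2_quadrant_neq0[q /TU[/ET[_ E1 E2] TUq]].
by rewrite -TUq; apply: value_at_neq0; exact: poly_subst_value E1 E2.
Qed.

Lemma represents_comp E F T U : dominant E -> represents E T -> represents F U ->
  represents (ratmap_comp F E) (U \o T).
Proof.
move=> dE ET FU q /ET[QT E1 E2]; have [QU F1 F2] := FU _ QT.
by split=> //=; apply: (ratfun_subst_value dE E1 E2).
Qed.

Section Inverse.
Variables (E F : ratmap K) (T U : K * K -> K * K).
Hypotheses (ET : represents E T) (FU : represents F U).
Hypotheses (TU : forall q, Q q -> T (U q) = q) (UT : forall q, Q q -> U (T q) = q).

Lemma represents_inverse : birational_inverse E F.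
Proof.
have dE : dominant E.
  by apply: (represents_dominant ET (U := U)) => q Qq; have [QU _ _] := FU Qq; rewrite TU.
have dF : dominant F.
  by apply: (represents_dominant FU (U := T)) => q Qq; have [QT _ _] := ET Qq; rewrite UT.
split=> //; apply: represents_inj represents_id.
  by apply: represents_ext (represents_comp dE ET FU) _ => q Qq /=; rewrite UT.
by apply: represents_ext (represents_comp dF FU ET) _ => q Qq /=; rewrite TU.
Qed.

(** Nothing is known about the values of [G], so the two inverses are compared
    through the numerators and denominators of their coordinates. *)
Lemma birational_inverse_uniq G : birational_inverse E G -> G = F.
Proof.
move=> [dE dG GE _].
have key (h g z : ratfun K) (w : K * K -> K) : ratfun_subst E h = z ->
    (forall q, Q q -> value_at q z (w q)) ->
    (forall q, Q q -> value_at q g (w (U q))) -> h = g.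
  move=> hz zw gw; pose n := \n_(repr h); pose d := \d_(repr h).
  have d0 : d != 0 by exact: denom_ratioP.
  have hnd : h = tofrac n / tofrac d by rewrite -ratfun_numden mulfK // tofrac_eq0.
  pose n' := \n_(repr g); pose d' := \d_(repr g).
  have d'0 : d' != 0 by exact: denom_ratioP.
  have gnd : g = tofrac n' / tofrac d' by rewrite -ratfun_numden mulfK // tofrac_eq0.
  rewrite hnd gnd; apply/eqP; rewrite eqr_div ?tofrac_eq0 // -!tofracM tofrac_eq.
  rewrite -subr_eq0; apply/negPn/negP => /eval2_quadrant_neq0[q Qq].
  rewrite eval2D eval2N !eval2M (value_at_frac gnd d'0 (gw _ Qq)).
  have [QU _ _] := FU Qq; have [QT E1 E2] := ET QU.
  have /= := value_atM (zw _ QU) (poly_subst_value d E1 E2).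
  rewrite -hz hnd ratfun_subst_frac // divfK ?dE // => /value_at_uniq.
  move=> /(_ _ (poly_subst_value n E1 E2)); rewrite TU // => <-.
  by rewrite mulrAC subrr eqxx.
case: G GE dG => G1 G2 [/= GE1 GE2] _; case: F FU => F1 F2 FU'.
have -> : G1 = F1.
  by apply: (key _ _ _ fst GE1) => [q _|q /FU'[]//]; exact: value_at_x.
suff -> : G2 = F2 by [].
by apply: (key _ _ _ snd GE2) => [q _|q /FU'[]//]; exact: value_at_y.
Qed.

End Inverse.
End Representation.

Section DihedralOrder.
Variables (K : realType) (a b : K -> K) (E1 E2 : ratmap K).
Hypothesis a_gt0 : forall y : K, 0 < y -> 0 < a y.
Hypothesis b_gt0 : forall x : K, 0 < x -> 0 < b x.
Hypothesis E1_flip : represents E1 (flip a b false).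
Hypothesis E2_flip : represents E2 (flip a b true).
Local Notation Q := (@quadrant K).
Local Notation alt := (alternate a b).
Local Notation G := (generated_subgroup [set E1; E2]).

Fixpoint word n : ratmap K :=
  if n is m.+1 then ratmap_comp (if odd m then E2 else E1) (word m)
  else ratmap_id K.

Lemma dominant_alternate E n : represents E (alt n) -> dominant E.
Proof.
move=> En; apply: (represents_dominant En (U := unalternate a b n)) => q Qq.
by rewrite unalternateK //; split=> //; exact: unalternate_quadrant.
Qed.

Lemma word_alternate n : represents (word n) (alt n).
Proof.
elim: n => [|n IHn] /=; first exact: represents_id.
have dn := dominant_alternate IHn.
by case: (odd n); apply: represents_comp.
Qed.

Lemma word_generated n : G (word n).
Proof.
move=> A /= [[_ Aid Acomp _] AE]; elim: n => //= n IHn.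
by apply: Acomp => //; apply: AE; case: (odd n); [right|left].
Qed.

Section Period.
Variable d : nat.
Hypotheses (d_gt0 : (0 < d)%N) (d2 : ~~ odd d).
Hypothesis altd : forall q, Q q -> alt d q = q.

(** Under periodicity, a flip prolongs or shortens the word; the one that would
    precede the empty word is supplied by the last letter of the period. *)
Lemma flip_alternate c r : exists r', forall q, Q q -> flip a b c (alt r q) = alt r' q.
Proof.
have [<-|/negPf/= rc] := eqVneq (odd r) c; first by exists r.+1.
case: r rc => [|r] /=.
  case: c => // _; move: d2; case: d d_gt0 altd => // m _ dq d2'.
  have /negPn md : ~~ ~~ odd m by [].
  exists m => q Qq.
  have := dq q Qq; rewrite [LHS]/= md => e.
  by rewrite -[in LHS]e flipK //; apply: alternate_quadrant.
move=> rc; have {rc} <- : odd r = c by move: rc; case: (odd r); case: c.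
by exists r => q Qq; rewrite flipK //; apply: alternate_quadrant.
Qed.

Lemma alternate_comp k n : exists r, forall q, Q q -> alt k (alt n q) = alt r q.
Proof.
elim: k => [|k [r IHr]]; first by exists n.
have [r' Hr'] := flip_alternate (odd k) r.
by exists r' => q Qq /=; rewrite IHr // Hr'.
Qed.

Lemma alternate_inverse n : exists m,
  forall q, Q q -> alt m (alt n q) = q /\ alt n (alt m q) = q.
Proof.
elim: n => [|n [m IHm]]; first by exists 0%N.
have [k Hk] := flip_alternate (odd n) 0.
have [r Hr] := alternate_comp m k; exists r => q Qq /=; split.
  rewrite -Hr -?Hk /=; [|exact: flip_quadrant (alternate_quadrant _ _ _ _)..].
  by rewrite flipK ?(IHm _ _).1 //; exact: alternate_quadrant.
rewrite -Hr // -Hk //= (IHm _ _).2 ?flipK //; exact: flip_quadrant.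
Qed.

Lemma alternate_mod n q : Q q -> alt n q = alt (n %% d) q.
Proof.
move=> Qq; rewrite {1}(divn_eq n d) addnC alternateD ?oddM ?negb_and ?d2 ?orbT //.
congr alt; elim: (_ %/ _)%N => // m IHm.
by rewrite mulSn addnC alternateD // altd.
Qed.

Lemma generated_words : G = word @` `I_d.
Proof.
apply/seteqP; split=> [E|_ [n _ <-]]; last exact: word_generated.
suff /(_ E) GE : G `<=` [set E | exists n, represents E (alt n)].
  move=> /GE[n En]; exists (n %% d)%N; first exact: ltn_pmod.
  apply: represents_inj (word_alternate _) _.
  by apply: represents_ext En _ => q /alternate_mod.
apply: smallest_sub => [|_ [->|->]]; last 2 first.
- by exists 1%N.
- have [r Hr] := flip_alternate true 0; exists r.
  exact: represents_ext E2_flip Hr.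
split=> [{}E [n En]||{}E F [n En] [m Fm]|{}E F [n En] EF].
- have [m nm] := alternate_inverse n; exists (word m).
  by apply: represents_inverse En (word_alternate m) _ _ => q /nm[].
- by exists 0%N; exact: represents_id.
- have [r Hr] := alternate_comp m n; exists r.
  exact: represents_ext (represents_comp (dominant_alternate En) En Fm) Hr.
- have [m nm] := alternate_inverse n; exists m.
  rewrite (birational_inverse_uniq En (word_alternate m) _ EF) => [|q /nm[]//].
  exact: word_alternate.
Qed.

End Period.

Lemma word_eq n m : (n <= m)%N -> word n = word m ->
  ~~ odd (m - n) /\ forall q, Q q -> alt (m - n) q = q.
Proof.
move=> nm e; apply: (alternate_eq a_gt0 b_gt0 (n := n)) => q Qq.
rewrite subnKC //; apply: represents_fun Qq; [exact: word_alternate|].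
by rewrite e; exact: word_alternate.
Qed.

(** Among the first eleven words two coincide if the group has ten elements, and
    then the group has at most as many elements as the period.  Conversely,
    a shorter even period together with 10 would give period 2, that is, two
    equal involutions that move different coordinates. *)
Lemma generated_order10 :
  (G #= `I_10)%card <-> forall q, Q q -> alt 10 q = q.
Proof.
split=> [G10|alt10].
  have [n [m [nm m10 e]]] : exists n m, [/\ (n < m)%N, (m <= 10)%N & word n = word m].
    apply: contrapT => H.
    have : (word @` `I_11 #= `I_11)%card.
      apply: inj_card_eq => i j; rewrite !inE /= !ltnS => i10 j10 e.
      by apply/eqP; case: ltngtP => // ij; exfalso; apply: H;
        [exists i, j|exists j, i].
    move=> e; suff : (`I_11 #<= `I_10)%card by rewrite card_le_II.
    rewrite -(card_le_eql e) -(card_le_eqr G10).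
    by apply: subset_card_le => _ [i _ <-]; exact: word_generated.
  have [d2 dq] := word_eq (ltnW nm) e.
  have d0 : (0 < m - n)%N by rewrite subn_gt0.
  move: G10; rewrite (generated_words d0 d2 dq) => G10.
  have : (`I_10 #<= `I_(m - n))%card.
    by rewrite -(card_le_eql G10); exact: card_image_le.
  rewrite card_le_II => d10; have <- // : (m - n = 10)%N.
  by apply/eqP; rewrite eqn_leq d10 andbT (leq_trans (leq_subr _ _)).
rewrite (@generated_words 10) //; apply: inj_card_eq => i j; rewrite !inE /=.
wlog ij : i j / (i <= j)%N.
  move=> H i10 j10 e; have [/H|/ltnW/H] := leqP i j; first exact.
  by move=> H'; apply/esym/H'.
move=> _ j10 e; have [d2 dq] := word_eq ij e.
have no2 : ~ forall q, Q q -> alt 2 q = q.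
  move=> alt2; apply: (@flip_not_id _ a b false) => q Qq.
  have := alt2 q Qq; rewrite -[LHS]/(flip a b true (flip a b false q)).
  move=> /(congr1 (flip a b true)).
  rewrite flipK //; last exact: flip_quadrant.
  by case: q {Qq} => x y [xy _]; rewrite /flip /= xy.
have altD m n q : ~~ odd n -> Q q -> alt n q = q -> alt (m + n) q = alt m q.
  by move=> n2 Qq nq; rewrite alternateD // nq.
have jid : (j - i < 10)%N by rewrite (leq_ltn_trans _ j10) // leq_subr.
suff /eqP : (j - i)%N = 0%N by rewrite subn_eq0 => ji; apply/eqP; rewrite eqn_leq ij ji.
move: (j - i)%N jid d2 dq => D; do 10?[case: D => [|D]] => // _ _ dq; case: no2 => q Qq.
- by rewrite -[RHS]alt10 // -[10%N]/(2 + 4 + 4)%N !altD ?dq.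
- have alt4 p : Q p -> alt 4 p = p.
    by move=> Qp; rewrite -[RHS]alt10 // -[10%N]/(4 + 6)%N !altD ?dq.
  by rewrite -[RHS]dq // -[6%N]/(2 + 4)%N !altD ?alt4.
- by rewrite -[RHS]alt10 // -[10%N]/(2 + 8)%N !altD ?dq.
Qed.

End DihedralOrder.

(** * The group of a walk on the positive quadrant *)

Section Walk.
Variable K : realType.
Local Notation Q := (@quadrant K).
Implicit Types (P : 'M[K]_3) (k l : 'I_3) (q : K * K).

(** A border row of the matrix, cleared of denominators.  The columns are rows
    of the transpose, so that both a and b are instances of [border_ratio]. *)
Definition border_poly P k (t : K) : K := P k 0 * t ^+ 2 + P k 1 * t + P k 2.

Definition border_ratio P (t : K) : K := border_poly P 2 t / border_poly P 0 t.

Definition touches_border P : Prop :=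
  [/\ exists l, P 0 l != 0, exists l, P 2 l != 0,
      exists l, P^T 0 l != 0 & exists l, P^T 2 l != 0].

Definition periodic10 P : Prop :=
  forall q, Q q -> alternate (border_ratio P) (border_ratio P^T) 10 q = q.

Lemma ord3P (C : 'I_3 -> Prop) : C 0 -> C 1 -> C 2 -> forall k, C k.
Proof.
move=> C0 C1 C2 [[|[|[|//]]] lt].
- by rewrite (_ : Ordinal lt = 0) //; apply: val_inj.
- by rewrite (_ : Ordinal lt = 1) //; apply: val_inj.
- by rewrite (_ : Ordinal lt = 2) //; apply: val_inj.
Qed.

Lemma border_poly_gt0 P k t : (forall k l, 0 <= P k l) -> (exists l, P k l != 0) ->
  0 < t -> 0 < border_poly P k t.
Proof.
move=> P0 [l Pl] t0; have t2 : 0 < t ^+ 2 by rewrite exprn_gt0.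
have : 0 < P k l by rewrite lt0r Pl P0.
have := P0 k 0; have := P0 k 1; have := P0 k 2; rewrite /border_poly.
by elim/ord3P: l {Pl}; nra.
Qed.

Lemma border_ratio_gt0 P t : (forall k l, 0 <= P k l) -> touches_border P ->
  0 < t -> 0 < border_ratio P t.
Proof. by move=> P0 [? ? _ _] t0; apply: divr_gt0; apply: border_poly_gt0. Qed.

Lemma trmx_ge0 P : (forall k l, 0 <= P k l) -> forall k l, 0 <= P^T k l.
Proof. by move=> P0 k l; rewrite mxE. Qed.

Lemma touches_border_trmx P : touches_border P -> touches_border P^T.
Proof. by move=> [? ? ? ?]; split; rewrite ?trmxK. Qed.

Lemma row_laurent_value P k q : q.2 != 0 ->
  value_at q (row_laurent P k) (border_poly P k q.2 / q.2).
Proof.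
move=> q0; rewrite /row_laurent sum3E.
rewrite [step 0]/= [step 1]/= [step 2]/= expr1z expr0z mulr1.
have -> : border_poly P k q.2 / q.2 = P k 0 * q.2 + P k 1 + P k 2 * q.2^-1.
  by rewrite /border_poly; field.
have cv := @value_at_const K q; have yv := value_at_y q.
apply: value_atD; first by apply: value_atD => //; apply: value_atM.
by apply: value_atM => //; apply: value_atV.
Qed.

Lemma col_laurent_value P k q : q.1 != 0 ->
  value_at q (col_laurent P k) (border_poly P^T k q.1 / q.1).
Proof.
move=> q0; rewrite /col_laurent sum3E.
rewrite [step 0]/= [step 1]/= [step 2]/= expr1z expr0z mulr1.
have -> : border_poly P^T k q.1 / q.1 = P 0 k * q.1 + P 1 k + P 2 k * q.1^-1.
  by rewrite /border_poly !mxE; field.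
have cv := @value_at_const K q; have yv := value_at_x q.
apply: value_atD; first by apply: value_atD => //; apply: value_atM.
by apply: value_atM => //; apply: value_atV.
Qed.

Lemma nondegenerate_walkE P : (forall k l, 0 <= P k l) ->
  nondegenerate_walk P <-> touches_border P.
Proof.
move=> P0; have P0' := trmx_ge0 P0.
have Q1 : Q (1, 1) by split=> /=; rewrite ltr01.
have rowE k : row_laurent P k != 0 <-> exists l, P k l != 0.
  split=> [|Pk]; last first.
    apply: (value_at_neq0 (row_laurent_value P k (q := (1, 1)) _)).
      exact: oner_neq0.
    by rewrite divr1 gt_eqF // border_poly_gt0 // ltr01.
  apply: contra_neqP => /forallNP Pk; apply: big1 => l _.
  have /negP/negPn/eqP -> := Pk l; by rewrite rmorph0 mul0r.
have colE k : col_laurent P k != 0 <-> exists l, P^T k l != 0.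
  split=> [|Pk]; last first.
    apply: (value_at_neq0 (col_laurent_value P k (q := (1, 1)) _)).
      exact: oner_neq0.
    by rewrite divr1 gt_eqF // border_poly_gt0 // ltr01.
  apply: contra_neqP => /forallNP Pk; apply: big1 => l _.
  have /negP/negPn/eqP := Pk l; rewrite mxE => ->; by rewrite rmorph0 mul0r.
rewrite /nondegenerate_walk /A1 /C1 /A2 /C2 /touches_border.
have [r0 r0'] := rowE 0; have [r2 r2'] := rowE 2.
have [c0 c0'] := colE 0; have [c2 c2'] := colE 2.
split=> -[h1 h2 h3 h4]; split.
- exact: r0 h1.
- exact: r2 h2.
- exact: c0 h3.
- exact: c2 h4.
- exact: r0' h1.
- exact: r2' h2.
- exact: c0' h3.
- exact: c2' h4.
Qed.

Lemma walk_group_order10 P : (forall k l, 0 <= P k l) -> touches_border P ->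
  (walk_group P #= `I_10)%card <-> periodic10 P.
Proof.
move=> P0 bP; have P0' := trmx_ge0 P0; have bP' := touches_border_trmx bP.
have ga t : 0 < t -> 0 < border_ratio P t by exact: border_ratio_gt0.
have gb t : 0 < t -> 0 < border_ratio P^T t by exact: border_ratio_gt0.
have [b0 b2 b0' b2'] := bP.
apply: generated_order10 => // q Qq; have [q1 q2] := Qq;
  have q10 := lt0r_neq0 q1; have q20 := lt0r_neq0 q2;
  (split; first exact: flip_quadrant); [|exact: value_at_y|exact: value_at_x|].
- apply: value_at_eq.
    apply: value_at_div; first exact: row_laurent_value.
      by apply: value_atM; [exact: value_at_x|exact: row_laurent_value].
    by rewrite !mulf_neq0 ?invr_neq0 ?(gt_eqF (border_poly_gt0 P0 b0 q2)).
  rewrite /= /border_ratio; field.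
  by rewrite q10 q20 (gt_eqF (border_poly_gt0 P0 b0 q2)).
- apply: value_at_eq.
    apply: value_at_div; first exact: col_laurent_value.
      by apply: value_atM; [exact: value_at_y|exact: col_laurent_value].
    by rewrite !mulf_neq0 ?invr_neq0 ?(gt_eqF (border_poly_gt0 P0' b0' q1)).
  rewrite /= /border_ratio; field.
  by rewrite q10 q20 (gt_eqF (border_poly_gt0 P0' b0' q1)).
Qed.

End Walk.

(** * Orders of growth *)

Section Tropical.
Variable K : realType.
Implicit Types (f g : K -> K) (v w : int) (o : option int).

(** [f] has the exact order of t ^ v as t tends to 0, [None] standing for the
    zero function.  Two-sided bounds suffice: they already determine v, and they
    follow sums of nonnegative functions, where no cancellation can occur. *)
Definition order_at0 f o : Prop :=
  if o is Some v then
    exists2 C, 0 < C & forall t, 0 < t <= 1 -> t ^ v <= C * f t /\ f t <= C * t ^ v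
  else forall t, 0 < t <= 1 -> f t = 0.

Definition trop_add o1 o2 : option int :=
  match o1, o2 with
  | Some v, Some w => Some (Num.min v w)
  | Some v, None => Some v
  | None, _ => o2
  end.

Definition trop_mul o1 o2 : option int :=
  if (o1, o2) is (Some v, Some w) then Some (v + w) else None.

Definition trop_inv o : option int := omap -%R o.

Lemma exprz_anti (t : K) v w : 0 < t <= 1 -> v <= w -> t ^ w <= t ^ v.
Proof.
move=> /andP[t0 t1] vw; rewrite -[w]opprK -[v]opprK -(exprz_inv t (- w)) -(exprz_inv t (- v)).
by apply: ler_weXz2l; rewrite ?invf_ge1 ?lerN2.
Qed.

Lemma order_at0_ext f g o : (forall t, 0 < t <= 1 -> f t = g t) ->
  order_at0 f o -> order_at0 g o.
Proof.
by move=> fg; case: o => [v|] /= => [[C C0 H]|H];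
  [exists C => // t t01; rewrite -fg //; exact: H|move=> t t01; rewrite -fg // H].
Qed.

Lemma order_at0_const c : 0 <= c -> order_at0 (fun=> c) (if c != 0 then Some 0 else None).
Proof.
move=> c0; case: eqVneq => /= [-> //|c1]; have {c0 c1}c0 : 0 < c by rewrite lt0r c1.
have Vc : 0 < c^-1 by rewrite invr_gt0.
exists (c + c^-1) => [|t _]; first by rewrite addr_gt0.
rewrite expr0z mulrDl mulVf ?gt_eqF // mulr1; split.
  by rewrite lerDr mulr_ge0 ?ltW.
by rewrite lerDl ltW.
Qed.

Lemma order_at0_id : order_at0 id (Some 1).
Proof. by exists 1 => // t _; rewrite expr1z mul1r. Qed.

Lemma order_at0D f g o1 o2 : order_at0 f o1 -> order_at0 g o2 ->
  order_at0 (fun t => f t + g t) (trop_add o1 o2).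
Proof.
case: o1 o2 => [v|] [w|] //=; last first.
- by move=> f0 g0 t t01; rewrite f0 // g0 // addr0.
- by move=> f0 gw; apply: order_at0_ext (gw : order_at0 g (Some w)) => t t01; rewrite f0 // add0r.
- by move=> fv g0; apply: order_at0_ext (fv : order_at0 f (Some v)) => t t01; rewrite g0 // addr0.
move=> [C C0 fv] [D D0 gw]; exists (C + D) => [|t t01]; first by rewrite addr_gt0.
have [t0 t1] := andP t01; have [f1 f2] := fv t t01; have [g1 g2] := gw t t01.
have tv : 0 < t ^ v by rewrite exprz_gt0.
have tw : 0 < t ^ w by rewrite exprz_gt0.
have f0 : 0 <= f t by rewrite -(pmulr_rge0 _ C0) (le_trans (ltW tv)).
have g0 : 0 <= g t by rewrite -(pmulr_rge0 _ D0) (le_trans (ltW tw)).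
case: (leP v w) => [|/ltW] /(exprz_anti t01) vw; split; nra.
Qed.

Lemma order_at0M f g o1 o2 : order_at0 f o1 -> order_at0 g o2 ->
  order_at0 (fun t => f t * g t) (trop_mul o1 o2).
Proof.
case: o1 o2 => [v|] [w|] //=; last first.
- by move=> f0 g0 t t01; rewrite f0 // mul0r.
- by move=> f0 gw t t01; rewrite f0 // mul0r.
- by move=> fv g0 t t01; rewrite g0 // mulr0.
move=> [C C0 fv] [D D0 gw]; exists (C * D) => [|t t01]; first by rewrite mulr_gt0.
have [t0 t1] := andP t01; have [f1 f2] := fv t t01; have [g1 g2] := gw t t01.
have tv : 0 < t ^ v by rewrite exprz_gt0.
have tw : 0 < t ^ w by rewrite exprz_gt0.
have f0 : 0 <= f t by rewrite -(pmulr_rge0 _ C0) (le_trans (ltW tv)).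
have g0 : 0 <= g t by rewrite -(pmulr_rge0 _ D0) (le_trans (ltW tw)).
rewrite expfzDr ?gt_eqF //; split; rewrite mulrACA.
  by apply: ler_pM => //; exact: ltW.
by apply: ler_pM.
Qed.

Lemma order_at0V f o : order_at0 f o -> order_at0 (fun t => (f t)^-1) (trop_inv o).
Proof.
case: o => [v|] /= => [[C C0 fv]|f0 t t01]; last by rewrite f0 // invr0.
exists C => // t t01; have [t0 t1] := andP t01; have [f1 f2] := fv t t01.
have tv : 0 < t ^ v by rewrite exprz_gt0.
have f0 : 0 < f t by rewrite -(pmulr_rgt0 _ C0) (lt_le_trans tv).
have inv x y : 0 < x -> 0 < y -> x <= C * y -> y^-1 <= C * x^-1.
  by move=> x0 y0 xy; rewrite ler_pdivlMr // mulrC ler_pdivrMr.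
by rewrite -invr_expz; split; apply: inv.
Qed.

Lemma order_at0_uniq f o1 o2 : order_at0 f o1 -> order_at0 f o2 -> o1 = o2.
Proof.
have half : 0 < (1 : K) <= 1 by rewrite ltr01 lexx.
wlog : o1 o2 / if (o1, o2) is (Some v, Some w) then v < w else
               if o1 is Some _ then o2 = None else o2 = None.
  move=> H f1 f2; case: o1 o2 H f1 f2 => [v|] [w|] H f1 f2 //.
  - by case: (ltgtP v w) => [vw|wv|-> //]; [exact: H f1 f2|exact/esym/H].
  - exact: H f1 f2.
  - by apply/esym/H.
case: o1 o2 => [v|] [w|] //= vw.
  move=> [C C0 fv] [D D0 fw]; exfalso.
  pose t := (1 + C * D)^-1.
  have CD0 : 0 < C * D by rewrite mulr_gt0.
  have t0 : 0 < t by rewrite invr_gt0 addr_gt0.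
  have t1 : t <= 1 by rewrite invf_le1 ?lerDl ?ltW // addr_gt0.
  have t01 : 0 < t <= 1 by rewrite t0.
  have [f1 _] := fv t t01; have [_ f2] := fw t t01.
  have tv : 0 < t ^ v by rewrite exprz_gt0.
  have wv : t ^ w <= t ^ v * t.
    rewrite -[X in _ * X]expr1z -expfzDr ?gt_eqF //.
    by apply: exprz_anti; rewrite ?lezD1.
  have : t ^ v <= t ^ v * (C * D * t).
    apply: le_trans f1 _; apply: (le_trans (ler_wpM2l (ltW C0) f2)).
    rewrite mulrA [X in _ <= X]mulrCA; apply: ler_wpM2l => //; exact: ltW.
  rewrite -{1}[t ^ v]mulr1 ler_pM2l // /t ler_pdivlMr ?addr_gt0 // mul1r.
  by rewrite gerDr ler10.
move=> [C C0 fv] f0; have [] := fv 1 half; rewrite f0 // mulr0 exp1rz.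
by rewrite ler10.
Qed.

End Tropical.

(** * The support of a walk with a group of order 10 *)

Section TropicalOrbit.

Definition trop_poly (c2 c1 c0 : bool) (o : option int) : option int :=
  let at0 (c : bool) := if c then Some 0%Z else None in
  trop_add (trop_add (trop_mul (at0 c2) (trop_mul o o)) (trop_mul (at0 c1) o)) (at0 c0).

Definition trop_flip (A B : option int -> option int) (c : bool) (q : option int * option int) :=
  if c then (q.1, trop_mul (B q.1) (trop_inv q.2))
  else (trop_mul (A q.2) (trop_inv q.1), q.2).

Fixpoint trop_alternate A B n q :=
  if n is m.+1 then trop_flip A B (odd m) (trop_alternate A B m q) else q.

(** The arguments tell which weights are nonzero, named by the compass with the
    first row of the matrix to the north.  The starting point (1, 0) is the pair
    of orders of x = t and y = 1. *)
Definition trop_periodic (nw n ne w e sw s se : bool) : bool :=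
  let A o := trop_mul (trop_poly sw s se o) (trop_inv (trop_poly nw n ne o)) in
  let B o := trop_mul (trop_poly ne e se o) (trop_inv (trop_poly nw w sw o)) in
  trop_alternate A B 10 (Some 1, Some 0) == (Some 1, Some 0).

(** This and the next lemma are checks over the finitely many supports. *)
Lemma trop_periodic_corner nw n ne w e sw s se :
  trop_periodic nw n ne w e sw s se -> ~~ [&& nw, ne, sw & se].
Proof. by case: nw n ne w e sw s se => [] [] [] [] [] [] [] []; vm_compute. Qed.

Lemma trop_periodic_support n ne w e sw s se :
  [|| n | ne] -> [|| w | sw] -> [|| sw, s | se] -> [|| ne, e | se] ->
  trop_periodic false n ne w e sw s se -> [&& n, ne, w, sw & se].
Proof. by case: n ne w e sw s se => [] [] [] [] [] [] []; vm_compute. Qed.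

Variable K : realType.
Implicit Types (P : 'M[K]_3).

Lemma border_poly_order P k f o : (forall k l, 0 <= P k l) -> order_at0 f o ->
  order_at0 (fun t => border_poly P k (f t))
            (trop_poly (P k 0 != 0) (P k 1 != 0) (P k 2 != 0) o).
Proof.
move=> P0 fo; rewrite /border_poly /trop_poly.
apply: order_at0D; last exact: order_at0_const.
apply: order_at0D; apply: order_at0M => //; try exact: order_at0_const.
exact: order_at0_ext (order_at0M fo fo).
Qed.

Lemma periodic10_trop P : (forall k l, 0 <= P k l) -> touches_border P -> periodic10 P ->
  trop_periodic (P 0 0 != 0) (P 0 1 != 0) (P 0 2 != 0) (P 1 0 != 0) (P 1 2 != 0)
                (P 2 0 != 0) (P 2 1 != 0) (P 2 2 != 0).
Proof.
move=> P0 bP perP; rewrite /trop_periodic; set A := fun o => _; set B := fun o => _.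
have P0' := trmx_ge0 P0.
have key n : order_at0 (fun t => (alternate (border_ratio P) (border_ratio P^T) n (t, 1)).1)
      (trop_alternate A B n (Some 1, Some 0)).1 /\
    order_at0 (fun t => (alternate (border_ratio P) (border_ratio P^T) n (t, 1)).2)
      (trop_alternate A B n (Some 1, Some 0)).2.
  elim: n => [|n [IH1 IH2]].
    split; first exact: order_at0_id.
    by have := @order_at0_const K 1 ler01; rewrite oner_neq0.
  rewrite /= /flip /trop_flip; case: (odd n); split=> //=; apply: order_at0M;
    try exact: order_at0V; apply: order_at0M; try apply: order_at0V.
  - by have := border_poly_order 2 P0' IH1; rewrite !mxE.
  - by have := border_poly_order 0 P0' IH1; rewrite !mxE.
  - exact: border_poly_order.
  - exact: border_poly_order.
have [k1 k2] := key 10%N; apply/eqP.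
have Qt t : 0 < t <= 1 -> @quadrant K (t, 1) by move=> /andP[? _]; split; rewrite //= ltr01.
rewrite [LHS]surjective_pairing; congr pair.
  apply: (order_at0_uniq k1); apply: order_at0_ext (order_at0_id K) => t /Qt/perP.
  by move=> ->.
apply: (order_at0_uniq k2); have := @order_at0_const K 1 ler01.
by rewrite oner_neq0; apply: order_at0_ext => t /Qt/perP ->.
Qed.

End TropicalOrbit.

(** * Orbits of ratios of quadratic polynomials *)

Section RationalOrbit.
Variable F : fieldType.
Implicit Types c d e l m u w x y : F.

Definition quad_ratio c l u : F := (1 + c * u + u ^+ 2) / (1 + l * u).

Lemma quad_ratioV c l w : w != 0 -> 1 + l * w^-1 != 0 ->
  w + l != 0 /\ quad_ratio c l w^-1 = (1 + c * w + w ^+ 2) / (w + l) / w.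
Proof.
move=> w0 d0; have wl : w + l != 0.
  by apply: contraNneq d0 => e; rewrite -[1](mulfV w0) -mulrDl e mul0r.
split=> //; rewrite /quad_ratio; field.
by rewrite w0 wl.
Qed.

(** [u = w / z] is to have a pole where [z] vanishes and [w] does not. *)
Lemma quad_ratio_scale c l w z u : u = w / z -> z != 0 -> 1 + l * u != 0 ->
  z + l * w != 0 /\ z * quad_ratio c l u = (z ^+ 2 + c * z * w + w ^+ 2) / (z + l * w).
Proof.
move=> -> z0 d0; have wl : z + l * w != 0.
  by apply: contraNneq d0 => e; rewrite -[1](mulfV z0) mulrA -mulrDl e mul0r.
split=> //; rewrite /quad_ratio; field.
by rewrite z0 wl.
Qed.

Variables c e l m x y : F.

Let a := quad_ratio c l.
Let b := quad_ratio e m.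
Variables u2 u3 u4 u5 : F.
Hypotheses (E2 : u2 = a y / x) (E3 : u3 = b u2 / y) (E4 : u4 = a u3 / u2).
Hypothesis E5 : u5 = b u4 / u3.

Hypotheses (x0 : x != 0) (y0 : y != 0) (u20 : u2 != 0) (u30 : u3 != 0).
Hypotheses (dy : 1 + l * y != 0) (d2 : 1 + m * u2 != 0) (d3 : 1 + l * u3 != 0).

(* [w2] and [w3] are the inverses of [u2] and [u3]; all the expressions below
   make sense at the points where [u2] and [u3] have a pole. *)
Let w2 := (1 + l * y) * (x / (1 + c * y + y ^+ 2)).
Let g := (1 + e * w2 + w2 ^+ 2) / (w2 + m) / y.
Let w3 := w2 / g.

(** Rewriting the orbit in the inverses of its large terms removes every
    indeterminate form: [g], the ratio of [u3] to [u2], stays finite. *)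
Lemma corner_orbit : [/\ u2 = w2^-1, w2 != 0, w2 + m != 0, g != 0 &
  [/\ u3 = w3^-1, w3 != 0, w3 + l != 0 & u4 = g * ((1 + c * w3 + w3 ^+ 2) / (w3 + l))]].
Proof.
have u2E : u2 = w2^-1 by rewrite E2 /w2 /a /quad_ratio !invfM !invrK mulrC [in RHS]mulrA mulrAC; ring.
have w20 : w2 != 0 by rewrite -invr_eq0 -u2E.
have [w2m bE] : w2 + m != 0 /\ b u2 = (1 + e * w2 + w2 ^+ 2) / (w2 + m) / w2.
  by rewrite u2E; apply: quad_ratioV; rewrite // -u2E.
have u3E : u3 = w3^-1 by rewrite E3 bE /w3 /g !invfM !invrK; ring.
have w30 : w3 != 0 by rewrite -invr_eq0 -u3E.
have g0 : g != 0 by apply: contraNneq w30 => g0; rewrite /w3 g0 invr0 mulr0.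
have [w3l aE] : w3 + l != 0 /\ a u3 = (1 + c * w3 + w3 ^+ 2) / (w3 + l) / w3.
  by rewrite u3E; apply: quad_ratioV; rewrite // -u3E.
split=> //; split=> //.
have -> : g = w2 / w3 by rewrite /w3 invfM invrK mulrA mulfV // mul1r.
rewrite [RHS]mulrC.
by rewrite E4 aE u2E invrK mulrAC -!mulrA.
Qed.

Hypothesis d4 : 1 + m * u4 != 0.
Let om := x / (1 + c * y + y ^+ 2).
Let Phi := ((om * (m * e - 1 + m * w2) / (w2 + m) + 1) / y
            + m * c * om + m * om * w3 + om / g) / (w3 + l).

(** Where [y] is the pole of [a], the term [u4] is the pole of [b].  The factor
    [1 + l * y] that makes [b u4] infinite is split off exactly, and it cancels
    against the pole of [u3], so [u5] stays finite. *)
Lemma pole_orbit : 1 + m * u4 = (1 + l * y) * Phi /\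
  u5 = (1 + e * u4 + u4 ^+ 2) * (om / g / Phi).
Proof.
have [u2E w20 w2m g0 [u3E w30 w3l u4E]] := corner_orbit.
have w2E : w2 = (1 + l * y) * om by [].
have w3E : w3 = (1 + l * y) * om / g by [].
have gE : m * g = ((1 + l * y) * (om * (m * e - 1 + m * w2) / (w2 + m) + 1) / y) - l.
  have -> : (1 + l * y) * (om * (m * e - 1 + m * w2) / (w2 + m) + 1) =
            w2 * (m * e - 1 + m * w2) / (w2 + m) + (1 + l * y) by rewrite w2E; ring.
  rewrite /g; field.
  by rewrite y0 w2m.
have main : 1 + m * u4 = (1 + l * y) * Phi.
  rewrite u4E /Phi [RHS]mulrA; apply: (mulIf w3l); rewrite [RHS]divfK //.
  have aux D N : D != 0 -> (1 + m * (g * (N / D))) * D = D + m * (g * N).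
    by move=> D0; field.
  rewrite aux //.
  have -> : m * (g * (1 + c * w3 + w3 ^+ 2)) = m * g + m * c * (g * w3) + m * (g * w3) * w3 by ring.
  have -> : g * w3 = (1 + l * y) * om by rewrite w3E mulrCA divff // mulr1.
  rewrite gE {1}w3E; ring.
split=> //; have P0 : Phi != 0 by apply: contraNneq d4 => P0; rewrite main P0 mulr0.
rewrite E5 /b /quad_ratio main u3E invrK w3E; field.
by rewrite dy P0 g0.
Qed.

End RationalOrbit.

(** * Closed orbits at the poles *)

Section Decagon.
Variable F : fieldType.
Implicit Types (c e l m : F) (v : nat -> F).

(** In the field of rational functions the first two conditions hold for the
    orbit of the generic point, although the values may vanish at some points. *)
Definition decagon c e l m v : Prop :=
  [/\ forall n, v n != 0,
      forall n, 1 + (if odd n then l else m) * v n != 0,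
      forall n, v n.+2 = (if odd n then quad_ratio e m else quad_ratio c l) (v n.+1) / v n,
      v 10%N = v 0%N & v 11%N = v 1%N].

(** Periodicity also runs the recurrence backwards from the starting pair. *)
Lemma decagon_back c e l m v : decagon c e l m v ->
  [/\ v 9%N = quad_ratio e m (v 0%N) / v 1%N, v 8%N = quad_ratio c l (v 9%N) / v 0%N,
      v 7%N = quad_ratio e m (v 8%N) / v 9%N & v 6%N = quad_ratio c l (v 7%N) / v 8%N].
Proof.
move=> [v0 _ vE v10 v11].
have back (u w z : F) : z != 0 -> w != 0 -> z = u / w -> w = u / z.
  move=> z0 w0 zE; have -> : u = w * z by rewrite zE mulrC divfK.
  by rewrite mulfK.
by split; apply: back; rewrite -?v11 -?v10 // vE.
Qed.

End Decagon.

(** The relation [R] stands for having a given value at a fixed point of the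
    plane.  Only the closure properties matter here, and stating them for
    abstract fields keeps the computations independent of the construction of
    the field of rational functions. *)
Section Places.
Variables (L K : fieldType) (R : L -> K -> Prop).
Hypothesis R1 : R 1 1.
Hypothesis RD : forall h g v w, R h v -> R g w -> R (h + g) (v + w).
Hypothesis RN : forall h v, R h v -> R (- h) (- v).
Hypothesis RM : forall h g v w, R h v -> R g w -> R (h * g) (v * w).
Hypothesis RV : forall h v, R h v -> v != 0 -> R h^-1 v^-1.
Hypothesis R_uniq : forall h v w, R h v -> R h w -> v = w.

Lemma RX2 h v : R h v -> R (h ^+ 2) (v ^+ 2).
Proof. by move=> hv; rewrite !expr2; exact: RM. Qed.

Lemma R_eq h v w : R h v -> v = w -> R h w.
Proof. by move=> ? <-. Qed.

Variables (c e l m : K) (cL eL lL mL : L) (v : nat -> L).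
Hypotheses (Rc : R cL c) (Re : R eL e) (Rl : R lL l) (Rm : R mL m).
Hypothesis dec : decagon cL eL lL mL v.

(* Leaves the nonvanishing of the values of the denominators. *)
Ltac place := repeat first
  [eassumption | exact: R1 | eapply RD | eapply RN | eapply RX2 | eapply RM | eapply RV].

Let v_neq0 n : v n != 0. Proof. by case: dec. Qed.
Let dy n : ~~ odd n.+1 -> 1 + lL * v n != 0.
Proof. by case: dec => _ + _ _ _ => /(_ n); rewrite /= negbK => + n1; rewrite n1. Qed.
Let dx n : ~~ odd n -> 1 + mL * v n != 0.
Proof. by case: dec => _ + _ _ _ => /(_ n) + n1; rewrite (negPf n1). Qed.
Let vE n : v n.+2 = (if odd n then quad_ratio eL mL else quad_ratio cL lL) (v n.+1) / v n.
Proof. by case: dec. Qed.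

(** On the line x = 0 the orbit passes through the corner where x and y are
    infinite, and there only the leading coefficients matter.  Stated for
    free terms, it applies to the orbit in both directions. *)
Lemma corner_value x y u2 u3 u4 y1 :
    u2 != 0 -> u3 != 0 -> 1 + mL * u2 != 0 -> 1 + lL * u3 != 0 ->
    u2 = quad_ratio cL lL y / x -> u3 = quad_ratio eL mL u2 / y ->
    u4 = quad_ratio cL lL u3 / u2 ->
    l != 0 -> m != 0 -> y1 != 0 -> 1 + c * y1 + y1 ^+ 2 != 0 ->
    R x 0 -> R y y1 -> R u4 (l * m * y1)^-1 /\ R u3^-1 0.
Proof.
move=> u20 u30 d2 d3 u2E u3E u4E l0 m0 y10 N0 Rx Ry.
have [_ w20 w2m g0 [u3W w30 w3l u4W]] := corner_orbit u2E u3E u4E u20 u30 d2 d3.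
rewrite u4W u3W invrK.
set w2 := (_ * (x / _)) in w20 w2m g0 w30 w3l *.
have Rw2 : R w2 0 by eapply R_eq; [by place|ring].
set g := (_ / y) in g0 w30 w3l *.
have Rg : R g (m * y1)^-1.
  by eapply R_eq; [by place; rewrite ?add0r|field; rewrite m0 y10].
set w3 := w2 / g in w30 w3l *.
have Rw3 : R w3 0.
  by eapply R_eq; [by place; rewrite invr_eq0 mulf_neq0|ring].
split=> //.
eapply R_eq; [by place; rewrite add0r|field].
by rewrite l0 m0 y10.
Qed.

(** On the line x = 0, the orbit of y = 1 reaches [v 6] forwards with value l m and
    backwards with value 1 / (l m). *)
Lemma place_origin_line : l != 0 -> m != 0 -> 1 + l^-1 != 0 -> 1 + c + 1 != 0 ->
  R (v 0%N) 0 -> R (v 1%N) 1 -> (l * m) ^+ 2 = 1.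
Proof.
move=> l0 m0 l1 c0 R0 R1'.
have [v9 v8 v7 v6] := decagon_back dec.
have N0 : 1 + c * 1 + 1 ^+ 2 != 0 by rewrite mulr1 expr1n.
have Rv9 : R (v 9%N) 1.
  rewrite v9 /quad_ratio; eapply R_eq; [place|]; rewrite ?mulr0 ?expr0n /= ?addr0 ?divr1 ?oner_neq0 //.
have o1 : (1 : K) != 0 by exact: oner_neq0.
have [Rv4 Rv3] : R (v 4%N) (l * m * 1)^-1 /\ R (v 3%N)^-1 0.
  exact: (corner_value (v_neq0 2) (v_neq0 3) (dx (n := 2) isT) (dy (n := 3) isT) (vE 0) (vE 1) (vE 2)).
have [Rv6 _] : R (v 6%N) (l * m * 1)^-1 /\ R (v 7%N)^-1 0.
  exact: (corner_value (v_neq0 8) (v_neq0 7) (dx (n := 8) isT) (dy (n := 7) isT) v8 v7 v6).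
have Rv5 : R (v 5%N) 0.
  rewrite vE /= /quad_ratio; eapply R_eq; [place|by rewrite mulr0].
  by rewrite mulr1 invfM mulrCA mulfV // mulr1.
have Rv6' : R (v 6%N) (l * m).
  rewrite vE /= /quad_ratio; eapply R_eq; [place|].
  - by rewrite mulr0 addr0.
  - by rewrite invr_eq0 !mulf_neq0.
  by field; rewrite l0 m0.
have := R_uniq Rv6 Rv6'; rewrite mulr1 => e1.
by rewrite expr2 -{1}e1 mulVf // mulf_neq0.
Qed.

Hypothesis lm : l * m = 1.
(* The numerator of [a] at its pole: it vanishes when [a] is affine. *)
Let N0 := 1 - c * m + m ^+ 2.
Hypothesis N0_neq0 : N0 != 0.

Let l_neq0 : l != 0.
Proof. by apply: contra_eq_neq lm => ->; rewrite mul0r eq_sym oner_neq0. Qed.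
Let m_neq0 : m != 0.
Proof. by apply: contra_eq_neq lm => ->; rewrite mulr0 eq_sym oner_neq0. Qed.
Let mE : m = l^-1.
Proof. by apply: (mulfI l_neq0); rewrite lm divff. Qed.

Ltac fieldnz := field; rewrite ?oppr_eq0 ?expf_eq0 ?oner_neq0 /= ?l_neq0 ?m_neq0 ?N0_neq0 //.

Lemma pole_value x1 : R (v 0%N) x1 -> R (v 1%N) (- m) ->
  exists om g Phi : L,
  [/\ 1 + mL * v 4%N = (1 + lL * v 1%N) * Phi,
      v 5%N = (1 + eL * v 4%N + v 4%N ^+ 2) * (om / g / Phi),
      (v 3%N)^-1 = (1 + lL * v 1%N) * om / g, g != 0 &
  [/\ R om (x1 / N0), R g (- l ^+ 2), R (v 4%N) (- l) &
      R Phi (((x1 / N0 * (m * e - 1) / m + 1) / (- m) + m * c * (x1 / N0)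
             - x1 / N0 / l ^+ 2) / l)]].
Proof.
move=> R0 R1'.
have [v2E v3E v4E v5E] : [/\ v 2%N = quad_ratio cL lL (v 1%N) / v 0%N,
  v 3%N = quad_ratio eL mL (v 2%N) / v 1%N, v 4%N = quad_ratio cL lL (v 3%N) / v 2%N
  & v 5%N = quad_ratio eL mL (v 4%N) / v 3%N] by rewrite !vE.
have n2 := v_neq0 2; have n3 := v_neq0 3; have d1 := dy (n := 1) isT.
have d2 := dx (n := 2) isT; have d3 := dy (n := 3) isT; have d4 := dx (n := 4) isT.
have [_ w20 w2m g0 [u3W w30 w3l u4W]] := corner_orbit v2E v3E v4E n2 n3 d2 d3.
have [P5 u5W] := pole_orbit v2E v3E v4E v5E (v_neq0 1) n2 n3 d1 d2 d3 d4.
have {}R1' : R (v 1%N) (- l^-1) by rewrite -mE.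
have N0E : 1 + c * (- l^-1) + (- l^-1) ^+ 2 = N0 by rewrite /N0 mE; ring.
set om := v 0%N / _ in P5 u5W; set w2 := (1 + _) * om in w20 w2m g0 u3W w30 w3l u4W P5 u5W.
set g := _ / v 1%N in g0 u3W w30 w3l u4W P5 u5W.
set w3 := w2 / g in u3W w30 w3l u4W P5 u5W; set Phi := _ / (w3 + lL) in P5 u5W.
have Rom : R om (x1 / N0) by rewrite -N0E; place; rewrite N0E.
have Rw2 : R w2 0.
  by eapply R_eq; [place|rewrite mulrN mulfV // subrr mul0r].
have ml0 : - l^-1 != 0 by rewrite oppr_eq0 invr_eq0.
have Rg : R g (- l ^+ 2).
  eapply R_eq; [by place; rewrite add0r|]. by rewrite mE; fieldnz.
have l20 : - l ^+ 2 != 0 by rewrite oppr_eq0 expf_neq0.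
have Rw3 : R w3 0 by eapply R_eq; [place|rewrite mul0r].
exists om, g, Phi; split=> //; first by rewrite u3W invrK.
split=> //.
  by rewrite u4W; eapply R_eq; [place; rewrite add0r|fieldnz].
eapply R_eq; first by place; rewrite add0r.
by rewrite mE; fieldnz.
Qed.

(** At (-l, -m) the term [v 5] returns to -m, the pole of [a], so that [v 6] and
    [v 7] are infinite there.  Backwards, [v 9] and [v 8] are infinite but the
    next term [v 7] is finite. *)
Lemma place_double_pole : 1 - e * l + l ^+ 2 != 0 ->
  R (v 0%N) (- l) -> R (v 1%N) (- m) -> False.
Proof.
move=> q0 R0 R1'; have [om [g [Phi [P4 v5W _ g0 [Rom Rg R4 RPhi]]]]] := pole_value R0 R1'.
set q := 1 - e * l + l ^+ 2 in q0.
have {}RPhi : R Phi (- q / N0).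
  apply: R_eq RPhi _; have N0E : N0 = 1 - c / l + (l ^+ 2)^-1 by rewrite /N0 mE exprVn.
  have cE : c = l * (1 + (l ^+ 2)^-1 - N0) by rewrite N0E; fieldnz.
  by rewrite cE mE /q; fieldnz.
have p0 : - q / N0 != 0 by rewrite mulf_neq0 ?invr_neq0 ?oppr_eq0.
have l20 : - l ^+ 2 != 0 by rewrite oppr_eq0 expf_neq0.
have ml0 : - m != 0 by rewrite oppr_eq0.
have nl0 : - l != 0 by rewrite oppr_eq0.
have R5 : R (v 5%N) (- m).
  by rewrite v5W; eapply R_eq; [place|rewrite mE /q; fieldnz; rewrite ?q0].
have [v9 v8 v7 _] := decagon_back dec.
(* [psi] and [z] vanish at the point; [V], [W] and [Y] are the finite values of
   [v 6], [v 9] and [v 8] once multiplied by them. *)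
pose psi := 1 + lL * v 5%N; pose z := 1 + mL * v 0%N.
have psi0 : psi != 0 := dy (n := 5) isT.
have z0 : z != 0 := dx (n := 0) isT.
have Rpsi : R psi 0 by eapply R_eq; [place|rewrite mulrN lm subrr].
have Rz : R z 0 by eapply R_eq; [place|rewrite mulrN mulrC lm subrr].
pose V := (1 + cL * v 5%N + v 5%N ^+ 2) / v 4%N.
have RVv : R V (- N0 / l) by eapply R_eq; [place|rewrite /N0; fieldnz].
have v6V : v 6%N = V / psi by rewrite vE /= /quad_ratio /V /psi mulrAC.
have [psiV bV] := quad_ratio_scale eL v6V psi0 (dx (n := 6) isT).
pose W := (1 + eL * v 0%N + v 0%N ^+ 2) / v 1%N.
have RW : R W (- q * l) by eapply R_eq; [place|rewrite mE /q; fieldnz].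
have v9W : v 9%N = W / z by rewrite v9 /quad_ratio /W /z mulrAC.
have [zW aW] := quad_ratio_scale cL v9W z0 (dy (n := 9) isT).
have W0 : l * (- q * l) != 0 by rewrite !mulf_neq0 ?oppr_eq0.
pose Y := (z ^+ 2 + cL * z * W + W ^+ 2) / (z + lL * W) / v 0%N.
have RY : R Y (q / l).
  by eapply R_eq; [place; rewrite ?add0r|fieldnz; rewrite ?q0].
have v8Y : v 8%N = Y / z by rewrite v8 /Y -aW [RHS]mulrAC [z * _]mulrC mulfK.
have [zY bY] := quad_ratio_scale eL v8Y z0 (dx (n := 8) isT).
have e1 : psi * quad_ratio eL mL (v 6%N) * W = v 5%N * psi * (z * quad_ratio eL mL (v 8%N)).
  have -> : quad_ratio eL mL (v 6%N) = v 7%N * v 5%N by rewrite [v 7%N]vE /= divfK.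
  have -> : quad_ratio eL mL (v 8%N) = v 7%N * v 9%N by rewrite v7 divfK.
  rewrite v9W; field; exact: z0.
rewrite bV bY in e1.
have V0 : m * (- N0 / l) != 0 by rewrite !mulf_neq0 ?oppr_eq0 ?invr_neq0.
have RL : R ((psi ^+ 2 + eL * psi * V + V ^+ 2) / (psi + mL * V) * W) (N0 * q * l).
  by eapply R_eq; [place; rewrite add0r|rewrite mE; fieldnz].
have RR : R (v 5%N * psi * ((z ^+ 2 + eL * z * Y + Y ^+ 2) / (z + mL * Y))) 0.
  by eapply R_eq; [place; rewrite add0r !mulf_neq0 ?invr_neq0|rewrite mulr0 mul0r].
rewrite e1 in RL; have /eqP := R_uniq RL RR.
by rewrite !mulf_eq0 (negPf N0_neq0) (negPf q0) (negPf l_neq0).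
Qed.

(** Here b(u) = 1 + l u.  Along y = -m the terms [v 5] and [1 + l * v 6] vanish
    together, and the value of their ratio is [v 7], which is also computed
    backwards.  The factor 1 + l u, with u the value of [v 9], clears the
    pole that [v 7] acquires when [v 9] is the pole of [a]. *)
Lemma place_pole_line x1 : eL = lL + mL -> lL * mL = 1 ->
  x1 != 0 -> 1 + l * x1 != 0 -> R (v 0%N) x1 -> R (v 1%N) (- m) ->
  let u := - l * (1 + l * x1) in
  let S := (1 - l ^+ 2) * (x1 / N0) / (- l ^+ 2) in
  let Phi := ((x1 / N0 * (m * e - 1) / m + 1) / (- m) + m * c * (x1 / N0)
             - x1 / N0 / l ^+ 2) / l in
  (1 + l * u) * (- Phi - S * (c - l)) = S * ((1 + l * u) + l * (1 + c * u + u ^+ 2) / x1) / u.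
Proof.
move=> eE lmL x10 lx0 R0 R1' u S0 Phi0.
have [om [g [Phi [P4 v5W v3W g0 [Rom Rg R4 RPhi]]]]] := pole_value R0 R1'.
have [v9 v8 v7 _] := decagon_back dec.
have bE n : ~~ odd n -> quad_ratio eL mL (v n) = 1 + lL * v n.
  move=> n2; rewrite /quad_ratio -[RHS](mulfK (dx n2)) eE; congr (_ / _).
  by transitivity (1 + (lL + mL) * v n + (lL * mL) * v n ^+ 2); [rewrite lmL mul1r|ring].
have l20 : - l ^+ 2 != 0 by rewrite oppr_eq0 expf_neq0.
have ml0 : - m != 0 by rewrite oppr_eq0.
have nl0 : - l != 0 by rewrite oppr_eq0.
(* [S] and [Xi] are [v 5] and [1 + lL * v 6] divided by [T], which vanishes. *)
pose T := 1 + lL * v 1%N; have T0 : T != 0 := dy (n := 1) isT.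
have RT : R T 0 by eapply R_eq; [place|rewrite mulrN lm subrr].
pose S := (1 + lL * v 4%N) * (om / g).
have RS : R S S0 by eapply R_eq; [place|rewrite /S0; fieldnz].
have v5S : v 5%N = T * S by rewrite [v 5%N]vE /= bE // v3W /S /T !mulrA; ring.
have R5 : R (v 5%N) 0 by rewrite v5S; eapply R_eq; [place|rewrite mul0r].
have d5 : 1 + lL * v 5%N != 0 := dy (n := 5) isT.
pose Xi := (lL * Phi + lL * S * (cL - lL + v 5%N) / (1 + lL * v 5%N)) / v 4%N.
have RXi : R Xi (- Phi0 - S0 * (c - l)).
  eapply R_eq; first by place; rewrite mulr0 addr0 oner_neq0.
  by rewrite mulr0 !addr0 divr1 -/Phi0 ; field.
have v6E : 1 + lL * v 6%N = T * Xi.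
  have v4l : lL * (T * Phi) = lL + v 4%N by rewrite -P4 mulrDr mulr1 mulrA lmL mul1r.
  transitivity ((lL * (T * Phi) + lL * v 5%N * (cL - lL + v 5%N) / (1 + lL * v 5%N)) / v 4%N).
    by rewrite v4l [v 6%N]vE /= /quad_ratio; field; rewrite d5 v_neq0.
  have aux (t s : L) : 1 + lL * (t * s) != 0 ->
      (lL * (t * Phi) + lL * (t * s) * (cL - lL + t * s) / (1 + lL * (t * s))) / v 4%N =
      t * ((lL * Phi + lL * s * (cL - lL + t * s) / (1 + lL * (t * s))) / v 4%N).
    by move=> ts; field; rewrite ts v_neq0.
  by rewrite /Xi v5S aux // -v5S.
have XiS : Xi = S * v 7%N.
  by apply: (mulfI T0); rewrite -v6E -bE // [RHS]mulrA -v5S [v 7%N]vE /= mulrC divfK.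
pose z := 1 + lL * v 9%N; have z0 : z != 0 := dy (n := 9) isT.
have Rv9 : R (v 9%N) u.
  by rewrite v9 bE //; eapply R_eq; [place|rewrite mE /u; fieldnz].
have u0 : u != 0 by rewrite mulf_neq0 ?oppr_eq0.
have Rz : R z (1 + l * u) by place.
have main : z * Xi = S * (z + lL * (1 + cL * v 9%N + v 9%N ^+ 2) / v 0%N) / v 9%N.
  by rewrite XiS v7 bE // v8 /quad_ratio -/z; field; rewrite z0 !v_neq0.
have := RM Rz RXi; rewrite main => RL; apply: (R_uniq RL).
by place.
Qed.

End Places.

(** * The orbit of the generic point *)

Section Orbit.
Variable F : fieldType.
Implicit Types (a b : F -> F) (p : F * F).

Fixpoint walk_orbit a b p n : F * F :=
  if n is k.+1 then
    let q := walk_orbit a b p k in (q.2, (if odd k then b else a) q.2 / q.1)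
  else p.

End Orbit.

Lemma alternate_walk_orbit (K : realType) (a b : K -> K) q n :
  alternate a b n q = if odd n then ((walk_orbit a b q n).2, (walk_orbit a b q n).1)
                      else walk_orbit a b q n.
Proof.
by elim: n => //= n ->; rewrite /flip; case: (odd n).
Qed.

(** Exchanging the roles of the two maps runs the word backwards. *)
Lemma periodic_swap (K : realType) (a b : K -> K) :
    (forall y : K, 0 < y -> 0 < a y) -> (forall x : K, 0 < x -> 0 < b x) ->
    (forall q, quadrant q -> alternate a b 10 q = q) ->
  forall q, quadrant q -> alternate b a 10 q = q.
Proof.
move=> a0 b0 per [y x] [/= y0 x0]; have Qxy : quadrant (x, y) by [].
have <- : ((unalternate a b 10 (x, y)).2, (unalternate a b 10 (x, y)).1) = (y, x).
  by rewrite -{1 2}(per _ Qxy) alternateK.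
by [].
Qed.

Section ClosedOrbits.
Variables (K : realType) (c e l m : K).
Hypotheses (c0 : 0 <= c) (e0 : 0 <= e) (l0 : 0 < l) (m0 : 0 < m).
Local Notation a := (quad_ratio c l).
Local Notation b := (quad_ratio e m).
Hypothesis per : forall q, quadrant q -> alternate a b 10 q = q.

Lemma quad_ratio_gt0 (d k u : K) : 0 <= d -> 0 < k -> 0 < u -> 0 < quad_ratio d k u.
Proof.
move=> d0 k0 u0; have ku : 0 < k * u by rewrite mulr_gt0.
have du : 0 <= d * u by rewrite mulr_ge0 // ltW.
have u2 : 0 < u ^+ 2 by rewrite exprn_gt0.
by apply: divr_gt0; lra.
Qed.

Lemma walk_orbit_gt0 q n : quadrant q -> 0 < (walk_orbit a b q n).1 /\ 0 < (walk_orbit a b q n).2.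
Proof.
move=> [q1 q2]; elim: n => //= n [IH1 IH2]; split=> //; apply: divr_gt0 => //.
by case: (odd n); apply: quad_ratio_gt0.
Qed.

Lemma decagon_point q : quadrant q -> decagon c e l m (fun n => (walk_orbit a b q n).1).
Proof.
move=> Qq; have per' := per Qq; rewrite alternate_walk_orbit in per'.
change (walk_orbit a b q 10 = q) in per'.
split=> [n|n|n||].
- by rewrite gt_eqF // (walk_orbit_gt0 n Qq).1.
- rewrite gt_eqF // addr_gt0 // mulr_gt0 ?(walk_orbit_gt0 n Qq).1 //; by case: ifP.
- by [].
- by rewrite per'.
- by rewrite -[LHS]/((walk_orbit a b q 10).2) per'.
Qed.

Local Notation const := (@ratfun_const K).

Lemma value_at_quad_ratio (d k u : K) h q : 1 + k * u != 0 -> value_at q h u ->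
  value_at q (quad_ratio (const d) (const k) h) (quad_ratio d k u).
Proof.
move=> ku hu; have cv := @value_at_const K q.
have o1 : value_at q 1 1 by have := cv 1; rewrite rmorph1.
rewrite /quad_ratio !expr2; apply: value_at_div => //.
  by apply: value_atD; [apply: value_atD => //; apply: value_atM|apply: value_atM].
by apply: value_atD => //; apply: value_atM.
Qed.

(** Positivity of the values on the quadrant shows that nothing vanishes along
    the orbit of the generic point, and injectivity of evaluation on the
    quadrant carries the periodicity over. *)
Lemma decagon_ratfun : exists v : nat -> ratfun K,
  [/\ decagon (const c) (const e) (const l) (const m) v, v 0%N = ratfun_x K & v 1%N = ratfun_y K].
Proof.
pose O := walk_orbit (quad_ratio (const c) (const l)) (quad_ratio (const e) (const m))
  (ratfun_x K, ratfun_y K).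
have val q n : quadrant q -> value_at q (O n).1 (walk_orbit a b q n).1 /\
                             value_at q (O n).2 (walk_orbit a b q n).2.
  move=> Qq; elim: n => [|n [IH1 IH2]].
    by split; [exact: value_at_x|exact: value_at_y].
  have [o1 o2] := walk_orbit_gt0 n Qq; split=> //=.
  apply: value_at_div; rewrite // ?gt_eqF //.
  by case: (odd n); apply: value_at_quad_ratio; rewrite // gt_eqF // addr_gt0 // mulr_gt0.
have Q1 : @quadrant K (1, 1) by split; rewrite /= ltr01.
have per1 q : quadrant q -> walk_orbit a b q 10 = q.
  by move=> Qq; have := per Qq; rewrite alternate_walk_orbit.
exists (fun n => (O n).1); split=> //; split=> [n|n|n||].
- apply: value_at_neq0 (val _ n Q1).1 _; by rewrite gt_eqF // (walk_orbit_gt0 n Q1).1.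
- pose k := if odd n then l else m; have k0 : 0 < k by rewrite /k; case: ifP.
  have -> : (if odd n then const l else const m) = const k by rewrite /k; case: ifP.
  have o1 := (walk_orbit_gt0 n Q1).1.
  apply: (@value_at_neq0 _ (1, 1) _ (1 + k * (walk_orbit a b (1, 1) n).1)).
    apply: value_atD; first by have := value_at_const (1, 1) (1 : K); rewrite rmorph1.
    by apply: value_atM; [exact: value_at_const|exact: (val _ n Q1).1].
  by rewrite gt_eqF // addr_gt0 // mulr_gt0.
- by [].
- apply: value_at_inj => q Qq; exists q.1; last exact: value_at_x.
  by have := (val q 10%N Qq).1; rewrite per1.
- apply: value_at_inj => q Qq; exists q.2; last exact: value_at_y.
  by have := (val q 10%N Qq).2; rewrite per1.
Qed.

End ClosedOrbits.

(** * The normalized equations *)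

Section Pentagon.
Variable K : realType.
Implicit Types (c e l m : K).

Definition closes c e l m : Prop :=
  [/\ 0 <= c, 0 <= e, 0 < l, 0 < m &
      forall q, quadrant q -> alternate (quad_ratio c l) (quad_ratio e m) 10 q = q].

Lemma closes_swap c e l m : closes c e l m -> closes e c m l.
Proof.
by move=> [c0 e0 l0 m0 per]; split=> //; apply: periodic_swap => // u u0; exact: quad_ratio_gt0.
Qed.

Lemma value_at1 (q : K * K) : value_at q 1 1.
Proof. by have := value_at_const q (1 : K); rewrite rmorph1. Qed.

Lemma closes_mul1 c e l m : closes c e l m -> l * m = 1.
Proof.
move=> [c0 e0 l0 m0 per]; have [v [dec v0 v1]] := decagon_ratfun c0 e0 l0 m0 per.
have lm0 : 0 < l * m by rewrite mulr_gt0.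
have : (l * m) ^+ 2 = 1.
  apply: (place_origin_line (value_at1 (0, 1)) (@value_atD _ _) (@value_atM _ _)
    (@value_atV _ _) (@value_at_uniq _ _) (value_at_const _ _) (value_at_const _ _)
    (value_at_const _ _) (value_at_const _ _) dec).
  - by rewrite gt_eqF.
  - by rewrite gt_eqF.
  - by rewrite gt_eqF // addr_gt0 ?invr_gt0.
  - by rewrite gt_eqF //; lra.
  - by rewrite v0; exact: value_at_x.
  - by rewrite v1; exact: value_at_y.
by move/eqP; rewrite sqrf_eq1 => /orP[/eqP //|/eqP lm]; move: lm0; rewrite lm oppr_gt0 ltr10.
Qed.

Lemma closes_pole_or_line c e l m : closes c e l m ->
  (1 - c * m + m ^+ 2 == 0) || (1 - e * l + l ^+ 2 == 0).
Proof.
move=> H; have lm := closes_mul1 H; have [c0 e0 l0 m0 per] := H.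
have [v [dec v0 v1]] := decagon_ratfun c0 e0 l0 m0 per.
apply/negPn/negP => /norP[N0 q0].
apply: (place_double_pole (value_at1 (- l, - m)) (@value_atD _ _) (@value_atN _ _) (@value_atM _ _)
    (@value_atV _ _) (@value_at_uniq _ _) (value_at_const _ _) (value_at_const _ _)
    (value_at_const _ _) (value_at_const _ _) dec lm N0 q0).
- by rewrite v0; exact: value_at_x.
- by rewrite v1; exact: value_at_y.
Qed.

(** For l <> 1 the point of y = -m is chosen so that [v 9] is -m as well: the left
    side of the relation vanishes and the right side is 1 - l^2.  For l = 1 that
    point would lie on x = 0, and (1, -1) serves instead. *)
Lemma closes_line c e l m : closes c e l m ->
  1 - e * l + l ^+ 2 = 0 -> 1 - c * m + m ^+ 2 = 0.
Proof.
move=> H q0; have lm := closes_mul1 H; have [c0 e0 l0 m0 per] := H.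
have [v [dec v0 v1]] := decagon_ratfun c0 e0 l0 m0 per.
apply/eqP/negPn/negP => N0.
have l0' : l != 0 by rewrite gt_eqF.
have mE : m = l^-1 by apply: (mulfI l0'); rewrite lm divff.
have eE : e = l + m by apply: (mulIf l0'); rewrite mulrDl (mulrC m) lm; move: q0; nra.
have rel x1 := place_pole_line (value_at1 (x1, - m)) (@value_atD _ _) (@value_atN _ _)
    (@value_atM _ _) (@value_atV _ _) (@value_at_uniq _ _) (value_at_const _ _)
    (value_at_const _ _) (value_at_const _ _) (value_at_const _ _) dec lm N0.
have {}rel x1 := rel x1 x1.
have eL : ratfun_const e = ratfun_const l + ratfun_const m by rewrite eE rmorphD.
have lmL : ratfun_const l * ratfun_const m = 1 :> ratfun K.
  by rewrite -rmorphM lm rmorph1.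
have x_at x1 : value_at (x1, - m) (v 0%N) x1 by rewrite v0; exact: value_at_x.
have y_at x1 : value_at (x1, - m) (v 1%N) (- m) by rewrite v1; exact: value_at_y.
have m0' : m != 0 by rewrite gt_eqF.
have [l1|l1] := eqVneq l 1.
  have m1 : m = 1 by rewrite mE l1 invr1.
  have e1 : 1 + l * 1 != 0 by rewrite mulr1 gt_eqF // addr_gt0.
  have := rel 1 eL lmL (oner_neq0 _) e1 (x_at 1) (y_at 1).
  rewrite eE l1 m1 /=.
  have N1 : 2 - c != 0 by move: N0; rewrite m1; apply: contra_neq => ?; lra.
  have N1' : 1 - c * 1 + 1 ^+ 2 = 2 - c by ring.
  rewrite N1'; set Phi := (_ - _ / 1 ^+ 2) / 1.
  have -> : Phi = - 2 by rewrite /Phi; field.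
  set S := (1 - 1 ^+ 2) * _ / _.
  have -> : S = 0 by rewrite /S; ring.
  by rewrite !mul0r; lra.
have l2 : 1 - l ^+ 2 != 0.
  apply: contraNneq l1 => /eqP; rewrite subr_eq0 eq_sym sqrf_eq1 => /orP[//|/eqP l1].
  by move: l0; rewrite l1 oppr_gt0 ltr10.
have x10 : (m ^+ 2 - 1) * m != 0.
  have -> : m ^+ 2 - 1 = (1 - l ^+ 2) * m ^+ 2 by rewrite mulrBl mul1r -exprMn lm expr1n.
  by rewrite !mulf_neq0 // expf_neq0.
have lx1 : 1 + l * ((m ^+ 2 - 1) * m) = m ^+ 2 by rewrite mE; field.
have uE : - l * m ^+ 2 = - m by rewrite mE; field.
have e1 : 1 + l * ((m ^+ 2 - 1) * m) != 0 by rewrite lx1 expf_neq0.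
have := rel _ eL lmL x10 e1 (x_at _) (y_at _); rewrite lx1 /= uE.
have -> : 1 + l * - m = 0 by rewrite mulrN lm subrr.
set X := (_ ^+ 2 - 1) * m in x10 *; set N := 1 - c * m + m ^+ 2 in N0 *.
have -> : 1 + c * - m + (- m) ^+ 2 = N by rewrite /N; ring.
rewrite mul0r add0r => /esym; rewrite (_ : _ / - m = 1 - l ^+ 2); first exact/eqP.
by rewrite mE; field; rewrite l0' N0 x10.
Qed.

(** The orbit of (1/l, l) is computed from both ends.  The two values of [v 6] and
    the two values of [v 5] give equations for M = l^2 whose only common root
    is 1. *)
Lemma closes_lines_eq1 c e l m : closes c e l m ->
  1 - e * l + l ^+ 2 = 0 -> 1 - c * m + m ^+ 2 = 0 -> l = 1.
Proof.
move=> H q0 p0; have lm := closes_mul1 H; have [c0 e0 l0 m0 per] := H.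
have l0' : l != 0 by rewrite gt_eqF.
have m0' : m != 0 by rewrite gt_eqF.
have mE : m = l^-1 by apply: (mulfI l0'); rewrite lm divff.
have eE : e = l + m by apply: (mulIf l0'); rewrite mulrDl (mulrC m) lm; move: q0; nra.
have cE : c = l + m by apply: (mulIf m0'); rewrite mulrDl lm; move: p0; nra.
have Q1 : quadrant (m, l) by [].
pose v n := (walk_orbit (quad_ratio c l) (quad_ratio e m) (m, l) n).1.
have dec : decagon c e l m v := decagon_point c0 e0 l0 m0 per Q1.
have [_ dv vE _ _] := dec; have [v9 v8 v7 v6] := decagon_back dec.
have aE n : odd n -> quad_ratio c l (v n) = 1 + l^-1 * v n.
  move=> n1; have := dv n; rewrite n1 => d; rewrite /quad_ratio cE mE; field.
  by rewrite d l0'.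
have bE n : ~~ odd n -> quad_ratio e m (v n) = 1 + l * v n.
  move=> n1; have := dv n; rewrite (negPf n1) => d.
  rewrite /quad_ratio -[RHS](mulfK d) eE; congr (_ / _).
  by transitivity (1 + (l + m) * v n + l * m * v n ^+ 2); [rewrite lm mul1r|ring].
have v0 : v 0%N = l^-1 by rewrite -mE.
have v1 : v 1%N = l by [].
have M0 : 0 < l ^+ 2 by rewrite exprn_gt0.
have n1 : 1 + 2 * l ^+ 2 != 0 by rewrite gt_eqF //; lra.
have n2 : 1 + 3 * l ^+ 2 != 0 by rewrite gt_eqF //; lra.
have n3 : l ^+ 2 + 2 != 0 by rewrite gt_eqF //; lra.
have n4 : l ^+ 2 + 3 != 0 by rewrite gt_eqF //; lra.
have v2 : v 2%N = 2 * l by rewrite vE /= aE // v0 v1; field.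
have v3 : v 3%N = (1 + 2 * l ^+ 2) / l by rewrite vE /= bE // v1 v2; field.
have v4 : v 4%N = (1 + 3 * l ^+ 2) / (2 * l ^+ 3) by rewrite vE /= aE // v2 v3; field; rewrite l0'.
have v5 : v 5%N = (1 + 5 * l ^+ 2) / (2 * l * (1 + 2 * l ^+ 2)).
  by rewrite vE /= bE // v3 v4; field; rewrite l0' n1.
have v6' : v 6%N = (4 * l ^+ 4 + 7 * l ^+ 2 + 1) * l / ((1 + 2 * l ^+ 2) * (1 + 3 * l ^+ 2)).
  by rewrite vE /= aE // v4 v5; field; rewrite l0' n1 n2.
have w9 : v 9%N = 2 / l by rewrite v9 bE // v0 v1; field.
have w8 : v 8%N = (l ^+ 2 + 2) / l by rewrite v8 aE // v0 w9; field.
have w7 : v 7%N = (l ^+ 2 + 3) * l / 2 by rewrite v7 bE // w8 w9; field.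
have w6 : v 6%N = (l ^+ 2 + 5) * l / (2 * (l ^+ 2 + 2)).
  by rewrite v6 aE // w7 w8; field; rewrite l0' n3.
have w5 : v 5%N = (l ^+ 4 + 7 * l ^+ 2 + 4) / ((l ^+ 2 + 2) * (l ^+ 2 + 3) * l).
  have [vn0 _ _ _ _] := dec.
  have e57 : quad_ratio e m (v 6%N) = v 7%N * v 5%N by rewrite [v 7%N]vE /= divfK.
  have -> : v 5%N = quad_ratio e m (v 6%N) / v 7%N by rewrite e57 mulrAC divff ?mul1r.
  by rewrite bE // w7 w6; field; rewrite l0' n3 n4.
pose M := l ^+ 2.
have two : (2 : K) != 0 by rewrite pnatr_eq0.
have M1 : (M - 1) ^+ 2 * (2 * M - 1) = 0.
  move: w6; rewrite v6' => /eqP; rewrite eqr_div ?mulf_neq0 // => /eqP h.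
  apply: (mulIf l0'); rewrite mul0r /M; move: h; lra.
have M2 : (M - 1) ^+ 2 * (M - 2) = 0.
  move: w5; rewrite v5 => /eqP; rewrite eqr_div ?mulf_neq0 // => /eqP h.
  apply: (mulIf l0'); rewrite mul0r /M; move: h; lra.
have /eqP : (M - 1) ^+ 2 = 0 by nra.
rewrite sqrf_eq0 subr_eq0 /M sqrf_eq1 => /orP[/eqP //|/eqP l1].
by move: l0; rewrite l1 oppr_gt0 ltr10.
Qed.

Lemma closes_pentagon c e l m : closes c e l m -> [/\ c = 2, e = 2, l = 1 & m = 1].
Proof.
move=> H; have lm := closes_mul1 H; have H' := closes_swap H.
have [p0 q0] : 1 - c * m + m ^+ 2 = 0 /\ 1 - e * l + l ^+ 2 = 0.
  have /orP[/eqP p0|/eqP q0] := closes_pole_or_line H.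
    by split=> //; exact: closes_line H' p0.
  by split=> //; exact: closes_line H q0.
have l1 := closes_lines_eq1 H q0 p0.
have m1 : m = 1 by rewrite -lm l1 mul1r.
by move: p0 q0; rewrite l1 m1; split=> //; lra.
Qed.

End Pentagon.

(** * Rescalings and symmetries *)

Section Conjugation.
Variable K : realType.
Implicit Types (a b : K -> K) (P : 'M[K]_3) (q : K * K).
Local Notation Q := (@quadrant K).

Lemma alternate_conj (D : K * K -> K * K) a b a' b' :
    (forall y : K, 0 < y -> 0 < a y) -> (forall x : K, 0 < x -> 0 < b x) ->
    (forall z q, Q q -> flip a' b' z (D q) = D (flip a b z q)) ->
  forall n q, Q q -> alternate a' b' n (D q) = D (alternate a b n q).
Proof.
move=> a0 b0 aD n q Qq; elim: n => //= n ->; rewrite aD //.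
exact: alternate_quadrant.
Qed.

Lemma alternate_rescale (s t : K) a b a' b' : 0 < s -> 0 < t ->
    (forall y : K, 0 < y -> 0 < a y) -> (forall x : K, 0 < x -> 0 < b x) ->
    (forall y : K, 0 < y -> a' (t * y) = s ^+ 2 * a y) ->
    (forall x : K, 0 < x -> b' (s * x) = t ^+ 2 * b x) ->
  (forall q, Q q -> alternate a b 10 q = q) <-> (forall q, Q q -> alternate a' b' 10 q = q).
Proof.
move=> s0 t0 a0 b0 aE bE; pose D q := (s * q.1, t * q.2).
have conj : forall n q, Q q -> alternate a' b' n (D q) = D (alternate a b n q).
  apply: alternate_conj => // z [x y] [/= x0 y0]; rewrite /flip /D; case: z => /=.
    by rewrite bE //; congr (_, _); field; rewrite !gt_eqF.
  by rewrite aE //; congr (_, _); field; rewrite !gt_eqF.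
have s0' : s != 0 by rewrite gt_eqF.
have t0' : t != 0 by rewrite gt_eqF.
split=> per q Qq.
  have Qq' : Q (s^-1 * q.1, t^-1 * q.2).
    by case: Qq => q1 q2; split; rewrite /= mulr_gt0 ?invr_gt0.
  by have := conj 10%N _ Qq'; rewrite per // /D /= !mulVKf // -surjective_pairing.
have QD : Q (D q) by case: Qq => q1 q2; split; rewrite /= mulr_gt0.
have := conj 10%N _ Qq; rewrite per // /D.
case: q {Qq QD} => x y; case: (alternate _ _ _ _) => x' y' /= [].
by move=> /(mulfI s0') -> /(mulfI t0') ->.
Qed.

Definition periodic_walk P : Prop := [/\ weighted_walk P, touches_border P & periodic10 P].

Lemma periodic_walkE P : periodic_walk P <->
  [/\ weighted_walk P, nondegenerate_walk P & (walk_group P #= `I_10)%card].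
Proof.
split=> -[W H1 H2]; have [P0 _] := W; have ND := nondegenerate_walkE P0.
  by have G10 := walk_group_order10 P0 H1; split=> //; [apply/ND|apply/G10].
by have tP := ND.1 H1; have G10 := walk_group_order10 P0 tP; split=> //; apply/G10.
Qed.

Lemma periodic_walk_trmx P : periodic_walk P -> periodic_walk P^T.
Proof.
move=> [[P0 P1] tP per]; split; [split|exact: touches_border_trmx|].
- exact: trmx_ge0.
- by rewrite -P1 exchange_big; apply: eq_bigr => k _; apply: eq_bigr => l _; rewrite mxE.
- rewrite /periodic10 trmxK; apply: periodic_swap => // t t0.
  exact: border_ratio_gt0.
  by apply: border_ratio_gt0 => //; [exact: trmx_ge0|exact: touches_border_trmx].
Qed.

Lemma rev_ord3 : [/\ rev_ord (0 : 'I_3) = 2, rev_ord (1 : 'I_3) = 1 & rev_ord (2 : 'I_3) = 0].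
Proof. by split; apply: val_inj. Qed.

Lemma periodic_walk_rows P : periodic_walk P -> periodic_walk (rev_rows P).
Proof.
move=> [[P0 P1] tP per]; have [r0 r1 r2] := rev_ord3.
have P0' := trmx_ge0 P0; have tP' := touches_border_trmx tP.
split.
- split; first by move=> k l; rewrite mxE.
  rewrite -P1 [RHS](reindex_inj rev_ord_inj) /=; apply: eq_bigr => k _.
  by apply: eq_bigr => l _; rewrite mxE.
- case: tP => [[i iP] [j jP] [k kP] [l lP]]; split.
  + by exists j; rewrite mxE r0.
  + by exists i; rewrite mxE r2.
  + by exists (rev_ord k); rewrite !mxE rev_ordK; rewrite mxE in kP.
  + by exists (rev_ord l); rewrite !mxE rev_ordK; rewrite mxE in lP.
- pose D q : K * K := (q.1^-1, q.2).
  have conj n p : Q p ->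
      alternate (border_ratio (rev_rows P)) (border_ratio (rev_rows P)^T) n (D p) =
      D (alternate (border_ratio P) (border_ratio P^T) n p).
    apply: alternate_conj => [t t0|t t0|z q [q1 q2]]; [exact: border_ratio_gt0..|].
    rewrite /flip /D; case: z => /=; congr (_, _).
      have rev k : border_poly (rev_rows P)^T k q.1^-1 = border_poly P^T k q.1 / q.1 ^+ 2.
        by rewrite /border_poly !mxE r0 r1 r2; field; rewrite gt_eqF.
      by rewrite /border_ratio !rev -mulf_div divff ?mulr1 // invr_eq0 expf_neq0 // gt_eqF.
    by rewrite /border_ratio /border_poly !mxE r0 r2 invrK invf_div mulrC invf_div.
  move=> q Qq; have QD : Q (D q) by case: Qq => q1 q2; split; rewrite //= invr_gt0.
  have DD : D (D q) = q by rewrite /D /= invrK -surjective_pairing.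
  by have := conj 10%N _ QD; rewrite DD per // DD.
Qed.

Lemma rev_colsE P : rev_cols P = (rev_rows P^T)^T.
Proof. by apply/matrixP => i j; rewrite !mxE. Qed.

Lemma periodic_walk_cols P : periodic_walk P -> periodic_walk (rev_cols P).
Proof. by rewrite rev_colsE => /periodic_walk_trmx/periodic_walk_rows/periodic_walk_trmx. Qed.

Lemma periodic_walk_symmetric P P' : square_symmetric P P' -> periodic_walk P -> periodic_walk P'.
Proof.
by move=> + gP; elim=> // P'' _ ?;
  [exact: periodic_walk_rows|exact: periodic_walk_cols|exact: periodic_walk_trmx].
Qed.

End Conjugation.

(** * The walks of the theorem *)

Section Family.
Variable K : realType.
Implicit Types (S R p : K) (P : 'M[K]_3).
Local Notation Q := (@quadrant K).

Lemma pentagon_periodic q : Q q -> alternate (+%R 1) (+%R 1) 10 q = q.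
Proof.
case: q => x y [x0 y0]; rewrite /= in x0 y0; rewrite alternate_walk_orbit.
change (walk_orbit (+%R (1 : K)) (+%R (1 : K)) (x, y) 10 = (x, y)).
have x0' : x != 0 by rewrite gt_eqF.
have y0' : y != 0 by rewrite gt_eqF.
have x1 : 1 + x != 0 by rewrite gt_eqF // addr_gt0.
have y1 : 1 + y != 0 by rewrite gt_eqF // addr_gt0.
have xy1 : 1 + x + y != 0 by rewrite gt_eqF // !addr_gt0.
pose o := walk_orbit (+%R (1 : K)) (+%R (1 : K)) (x, y).
have oE n : o n.+1 = ((o n).2, (1 + (o n).2) / (o n).1).
  by rewrite /o /=; case: (odd n).
have o5 : o 5 = (x, y).
  have -> : o 5 = (x, y).
    have o1 : o 1 = (y, (1 + y) / x) by rewrite oE.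
    have o2 : o 2 = ((1 + y) / x, (1 + x + y) / (x * y)).
      by rewrite oE o1 /=; congr (_, _); field; rewrite x0' y0'.
    have o3 : o 3 = ((1 + x + y) / (x * y), (1 + x) / y).
      rewrite oE o2 /=; congr (_, _); field; rewrite x0' y0' y1 //.
    have o4 : o 4 = ((1 + x) / y, x).
      by rewrite oE o3 /=; congr (_, _); field; rewrite x0' y0' xy1.
    by rewrite oE o4 /=; congr (_, _); field; rewrite y0' x1.
  by [].
have shift n : o (n + 5)%N = o n.
  by elim: n => [|n IHn]; [exact: o5|rewrite addSn !oE IHn].
by rewrite -[LHS]/(o (5 + 5)%N) shift.
Qed.

Definition pentagon_weight S R p : K :=
  S ^+ 3 * R + S ^+ 2 + S ^+ 3 * R ^+ 3 + p + 2 * S * R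
    + S ^+ 2 * R ^+ 4 + 2 * S * R ^+ 3 + R ^+ 2.

Definition pentagon_walk S R p : 'M[K]_3 :=
  (pentagon_weight S R p)^-1 *: mx_of_rows
     [:: [:: 0;                S ^+ 3 * R;     S ^+ 2];
         [:: S ^+ 3 * R ^+ 3;  p;              2 * S * R];
         [:: S ^+ 2 * R ^+ 4;  2 * S * R ^+ 3; R ^+ 2]].

Lemma pentagon_weight_gt0 S R p : 0 < S -> 0 < R -> 0 <= p -> 0 < pentagon_weight S R p.
Proof.
move=> S0 R0 p0; rewrite /pentagon_weight.
have pos i j : 0 < S ^+ i * R ^+ j by rewrite mulr_gt0 ?exprn_gt0.
have := pos 3%N 1%N; have := pos 2%N 0%N; have := pos 3%N 3%N; have := pos 1%N 1%N.
have := pos 2%N 4%N; have := pos 1%N 3%N; have := pos 0%N 2%N.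
by rewrite !expr1 !expr0 !mulr1 !mul1r -!mulrA; lra.
Qed.

Lemma sum_ord3 (f : 'I_3 -> K) : \sum_k f k = f 0 + f 1 + f 2.
Proof.
rewrite !big_ord_recl big_ord0 addr0 addrA.
by congr (f _ + f _ + f _); apply: val_inj.
Qed.

Lemma matrix3P (A B : 'M[K]_3) : [/\ A 0 0 = B 0 0, A 0 1 = B 0 1 & A 0 2 = B 0 2] ->
  [/\ A 1 0 = B 1 0, A 1 1 = B 1 1 & A 1 2 = B 1 2] ->
  [/\ A 2 0 = B 2 0, A 2 1 = B 2 1 & A 2 2 = B 2 2] -> A = B.
Proof.
move=> [? ? ?] [? ? ?] [? ? ?]; apply/matrixP => i j; move: i j.
by apply: ord3P; apply: ord3P.
Qed.

(** The substitution x = (R/S) X, y = Y/(S R) turns a and b into 1 + Y and 1 + X. *)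
Lemma pentagon_walk_periodic S R p : 0 < S -> 0 < R -> 0 <= p -> periodic_walk (pentagon_walk S R p).
Proof.
move=> S0 R0 p0; have Z0 := pentagon_weight_gt0 S0 R0 p0; set Z := pentagon_weight S R p in Z0.
have Z0' : Z != 0 by rewrite gt_eqF.
have S0' : S != 0 by rewrite gt_eqF.
have R0' : R != 0 by rewrite gt_eqF.
have VZ : 0 < Z^-1 by rewrite invr_gt0.
split.
- split.
    by apply: ord3P; apply: ord3P; rewrite !mxE /=; repeat (apply: mulr_ge0); rewrite ?exprn_ge0 // ltW.
  rewrite !sum_ord3 !mxE /= -/Z.
  by apply: (mulfI Z0'); rewrite mulr1 [in RHS]/Z /pentagon_weight; field.
- by split; exists 2; rewrite !mxE /= !mulf_neq0 ?expf_neq0 ?invr_neq0.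
- have R2S : 0 < R / S by rewrite divr_gt0.
  have SR : 0 < (S * R)^-1 by rewrite invr_gt0 mulr_gt0.
  apply: (proj1 (@alternate_rescale K _ _ (+%R 1) (+%R 1) _ _ R2S SR _ _ _ _)).
  5: exact: pentagon_periodic.
  + by move=> t t0; exact: addr_gt0.
  + by move=> t t0; exact: addr_gt0.
  + move=> t t0; rewrite /border_ratio /border_poly !mxE /= -/Z; field.
    rewrite S0' Z0' R0' gt_eqF //; apply: addr_gt0; rewrite ?mulr_gt0 ?exprn_gt0 ?mulr_gt0 //.
  + move=> t t0; rewrite /border_ratio /border_poly !mxE /= -/Z; field.
    rewrite S0' Z0' R0' gt_eqF //; apply: addr_gt0; rewrite ?mulr_gt0 ?exprn_gt0 ?mulr_gt0 //.
Qed.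

(** The scales [s] and [t] of x and y make the outer coefficients of both
    numerators and the constant coefficients of both denominators equal to 1.
    For the walks of the theorem they are R/S and 1/(S R), which dictates [R]
    and [S] at the end. *)
Lemma periodic_walk_family P : periodic_walk P -> P 0 0 = 0 ->
  exists S R p, [/\ 0 < S, 0 < R, 0 <= p & P = pentagon_walk S R p].
Proof.
move=> [[P0 P1] tP per] P00.
have := periodic10_trop P0 tP per; rewrite P00 eqxx.
have orP4 (k : 'I_3) (A : 'M[K]_3) : (exists l, A k l != 0) ->
    [|| A k 0 != 0, A k 1 != 0 | A k 2 != 0].
  by case=> l; move: l; apply: ord3P => ->; rewrite ?orbT.
have [/orP4 t0 /orP4 t2 /orP4 c0 /orP4 c2] := tP.
move: t0 c0 c2; rewrite !mxE P00 eqxx /= => t0 c0 c2 /trop_periodic_support.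
move=> /(_ t0 c0 t2 c2) {t0 c0 c2 t2}.
move=> /and5P[/negPf n01 /negPf n02 /negPf n10 /negPf n20 /negPf n22].
have pos k l : P k l == 0 = false -> 0 < P k l by move=> n; rewrite lt0r n P0.
have {n01}a0 := pos _ _ n01; have {n02}b0 := pos _ _ n02; have {n10}g0 := pos _ _ n10.
have {n20}h0 := pos _ _ n20; have {n22}k0 := pos _ _ n22.
pose s := Num.sqrt (P 2 2 / P 0 2); pose t := Num.sqrt (P 2 2 / P 2 0).
have s0 : 0 < s by rewrite sqrtr_gt0 divr_gt0.
have t0 : 0 < t by rewrite sqrtr_gt0 divr_gt0.
have s2 : P 0 2 * s ^+ 2 = P 2 2 by rewrite sqr_sqrtr ?divr_ge0 ?P0 // mulrCA divff ?mulr1 // gt_eqF.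
have t2 : P 2 0 * t ^+ 2 = P 2 2 by rewrite sqr_sqrtr ?divr_ge0 ?P0 // mulrCA divff ?mulr1 // gt_eqF.
have sqs : P 2 2 / P 0 2 = s ^+ 2 by rewrite -s2 mulrAC divff ?mul1r // gt_eqF.
have sqt : P 2 2 / P 2 0 = t ^+ 2 by rewrite -t2 mulrAC divff ?mul1r // gt_eqF.
pose c := P 2 1 * t / P 2 2; pose e := P 1 2 * s / P 2 2.
pose l := P 0 1 * t / P 0 2; pose m := P 1 0 * s / P 2 0.
have c0 : 0 <= c by rewrite divr_ge0 ?mulr_ge0 ?P0 ?ltW.
have e0 : 0 <= e by rewrite divr_ge0 ?mulr_ge0 ?P0 ?ltW.
have l0 : 0 < l by rewrite divr_gt0 ?mulr_gt0.
have m0 : 0 < m by rewrite divr_gt0 ?mulr_gt0.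
have cl : closes c e l m.
  split=> //; apply: (proj2 (@alternate_rescale K s t _ _ (border_ratio P) (border_ratio P^T)
    s0 t0 _ _ _ _)); last exact: per.
  - by move=> u; exact: quad_ratio_gt0.
  - by move=> u; exact: quad_ratio_gt0.
  - move=> u u0; rewrite /border_ratio /border_poly /quad_ratio P00.
    have -> : P 2 0 * (t * u) ^+ 2 + P 2 1 * (t * u) + P 2 2 = P 2 2 * (1 + c * u + u ^+ 2).
      by rewrite exprMn mulrA t2 /c; field; rewrite gt_eqF.
    have -> : 0 * (t * u) ^+ 2 + P 0 1 * (t * u) + P 0 2 = P 0 2 * (1 + l * u).
      by rewrite /l; field; rewrite gt_eqF.
    by rewrite -mulf_div sqs.
  - move=> u u0; rewrite /border_ratio /border_poly /quad_ratio !mxE P00.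
    have -> : P 0 2 * (s * u) ^+ 2 + P 1 2 * (s * u) + P 2 2 = P 2 2 * (1 + e * u + u ^+ 2).
      by rewrite exprMn mulrA s2 /e; field; rewrite gt_eqF.
    have -> : 0 * (s * u) ^+ 2 + P 1 0 * (s * u) + P 2 0 = P 2 0 * (1 + m * u).
      by rewrite /m; field; rewrite gt_eqF.
    by rewrite -mulf_div sqt.
have [c2 e2 l1 m1] := closes_pentagon cl.
pose R := Num.sqrt (s / t); pose S := R / s.
have R0 : 0 < R by rewrite sqrtr_gt0 divr_gt0.
have S0 : 0 < S by rewrite divr_gt0.
have R2 : R ^+ 2 = s / t by rewrite sqr_sqrtr // divr_ge0 // ltW.
(* The weights are now known up to the factor [r], which is fixed by their sum. *)
pose r := P 2 2 / R ^+ 2.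
have r0 : 0 < r by rewrite divr_gt0 // exprn_gt0.
have s0' : s != 0 by rewrite gt_eqF.
have t0' : t != 0 by rewrite gt_eqF.
have sS : s = R / S by rewrite /S invf_div mulrCA divff ?mulr1 // gt_eqF.
have tS : t = (S * R)^-1.
  by rewrite /S mulrAC -expr2 R2; field; rewrite s0' t0'.
exists S, R, (P 1 1 / r); split=> //; first by rewrite divr_ge0 ?P0 ?ltW.
have Z0 := pentagon_weight_gt0 S0 R0 (divr_ge0 (P0 1 1) (ltW r0)).
have S0' : S != 0 by rewrite gt_eqF.
have R0' : R != 0 by rewrite gt_eqF.
have E22 : P 2 2 = r * R ^+ 2 by rewrite divfK // expf_neq0.
have E02 : P 0 2 = r * S ^+ 2.
  by apply: (mulIf (expf_neq0 2 s0')); rewrite s2 E22 sS; field.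
have E20 : P 2 0 = r * (S ^+ 2 * R ^+ 4).
  by apply: (mulIf (expf_neq0 2 t0')); rewrite t2 E22 tS; field; rewrite S0' R0'.
have E01 : P 0 1 = r * (S ^+ 3 * R).
  have : P 0 1 * t = P 0 2 by rewrite -[RHS]mul1r -l1 divfK // gt_eqF.
  by move=> e01; apply: (mulIf t0'); rewrite e01 E02 tS; field; rewrite S0' R0'.
have E10 : P 1 0 = r * (S ^+ 3 * R ^+ 3).
  have : P 1 0 * s = P 2 0 by rewrite -[RHS]mul1r -m1 divfK // gt_eqF.
  by move=> e10; apply: (mulIf s0'); rewrite e10 E20 sS; field.
have E21 : P 2 1 = r * (2 * S * R ^+ 3).
  have : P 2 1 * t = 2 * P 2 2 by rewrite -c2 divfK // gt_eqF.
  by move=> e21; apply: (mulIf t0'); rewrite e21 E22 tS; field; rewrite S0' R0'.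
have E12 : P 1 2 = r * (2 * S * R).
  have : P 1 2 * s = 2 * P 2 2 by rewrite -e2 divfK // gt_eqF.
  by move=> e12; apply: (mulIf s0'); rewrite e12 E22 sS; field.
have E11 : P 1 1 = r * (P 1 1 / r) by rewrite mulrCA divff ?mulr1 // gt_eqF.
have rZ : r = (pentagon_weight S R (P 1 1 / r))^-1.
  apply: (mulIf (lt0r_neq0 Z0)); rewrite mulVf ?gt_eqF // -P1.
  rewrite !sum_ord3 P00 E01 E02 E10 E12 E20 E21 E22 /pentagon_weight.
  by field; rewrite gt_eqF.
by apply: matrix3P; split; rewrite !mxE /= -rZ ?mulr0.
Qed.

End Family.

Theorem theorem6p1 (K : realType) (Pinf : 'M[K]_3) :
  [/\ weighted_walk Pinf, nondegenerate_walk Pinf & (walk_group Pinf #= `I_10)%card] <->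
  exists S R P : K,
    let Z := S ^+ 3 * R + S ^+ 2 + S ^+ 3 * R ^+ 3 + P + 2 * S * R
             + S ^+ 2 * R ^+ 4 + 2 * S * R ^+ 3 + R ^+ 2 in
    [/\ 0 < S, 0 < R, 0 <= P &
        square_symmetric
          (Z^-1 *: mx_of_rows
             [:: [:: 0;                S ^+ 3 * R;     S ^+ 2];
                 [:: S ^+ 3 * R ^+ 3;  P;              2 * S * R];
                 [:: S ^+ 2 * R ^+ 4;  2 * S * R ^+ 3; R ^+ 2]])
          Pinf].
Proof.
rewrite -periodic_walkE; split=> [gP|[S [R [p [S0 R0 p0 sym]]]]]; last first.
  exact: periodic_walk_symmetric sym (pentagon_walk_periodic S0 R0 p0).
have rowsK (P : 'M[K]_3) : rev_rows (rev_rows P) = P.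
  by apply/matrixP => i j; rewrite !mxE rev_ordK.
have colsK (P : 'M[K]_3) : rev_cols (rev_cols P) = P.
  by apply/matrixP => i j; rewrite !mxE rev_ordK.
have [r0 r1 r2] := rev_ord3.
suff [g [gg g0 gK]] : exists g, [/\ periodic_walk g, g 0 0 = 0 &
    forall F, F = g -> square_symmetric F Pinf].
  have [S [R [p [S0 R0 p0 gE]]]] := periodic_walk_family gg g0.
  by exists S, R, p; split=> //; apply: gK.
have [[P0 _] tP per] := gP.
have /trop_periodic_corner := periodic10_trop P0 tP per.
rewrite !negb_and !negbK => /or4P[]/eqP corner.
- by exists Pinf; split=> // F ->; exact: Sym_refl.
- exists (rev_cols Pinf); split; [exact: periodic_walk_cols|by rewrite mxE r0|].
  by move=> F ->; rewrite -{2}(colsK Pinf); apply: Sym_cols; exact: Sym_refl.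
- exists (rev_rows Pinf); split; [exact: periodic_walk_rows|by rewrite mxE r0|].
  by move=> F ->; rewrite -{2}(rowsK Pinf); apply: Sym_rows; exact: Sym_refl.
- exists (rev_rows (rev_cols Pinf)); split.
  + exact/periodic_walk_rows/periodic_walk_cols.
  + by rewrite !mxE r0.
  + move=> F ->; rewrite -{2}(colsK Pinf) -{2}(rowsK (rev_cols Pinf)).
    by apply: Sym_cols; apply: Sym_rows; exact: Sym_refl.
Qed.
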